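(* Consider the discounted expected cost transmission scheduling problem with a single receiver, piecewise-linear convex power-rate curves and discount factor $\alpha\in[0,1)$, with finite horizon value functions $V_n$, functions $\tilde g_n$ and critical numbers $b_{n,k}(s)$ as described in the context. (a) For fixed $x\in[0,\infty)$ and $s\in\mathcal{S}$, $V_n(x,s)$ is nondecreasing in $n$. Moreover, $\lim_{n\to\infty}V_n(x,s)$ exists and is finite for all $x\in[0,\infty)$ and $s\in\mathcal{S}$. (b) Define $V_\infty(x,s):=\lim_{n\to\infty}V_n(x,s)$. Then $V_\infty(x,s)$ is convex in $x$ for any fixed $s\in\mathcal{S}$. (c) Define $\tilde g_\infty(y,s):=h(y-d)+\alpha\,\mathbb{E}[V_\infty(y-d,S')\mid S=s]$, where $S'$ is the channel condition in the slot following one with condition $S$. Then $\tilde g_n(y,s)$ converges monotonically to $\tilde g_\infty(y,s)$ for all $y\in[d,\infty)$ and $s\in\mathcal{S}$; $\tilde g_\infty(y,s)$ is convex in $y$ for any fixed $s\in\mathcal{S}$; and $\lim_{y\to\infty}\tilde g_\infty(y,s)=\infty$ for all $s\in\mathcal{S}$. (d) Define $b_{\infty,-1}(s):=\infty$ and $$b_{\infty,k}(s):=\max\Bigl\{d,\inf\{b:\tilde g_\infty^{\prime+}(b,s)\ge-\tilde c_k(s)\}\Bigr\},\quad k\in\{0,1,\ldots,K\},$$ where $\tilde g_\infty^{\prime+}(b,s):=\lim_{y\downarrow b}\frac{\tilde g_\infty(y,s)-\tilde g_\infty(b,s)}{y-b}$ is the right derivative. Then $b_{\infty,k}(s)=\lim_{n\to\infty}b_{n,k}(s)$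 for all $k\in\{-1,0,1,\ldots,K\}$. (e) $V_\infty$ satisfies the $\alpha$-discounted cost optimality equation $$V_\infty(x,s)=\min_{\max(0,d-x)\le z\le\tilde z_{\max}(s)}\bigl\{c(z,s)+h(x+z-d)+\alpha\,\mathbb{E}[V_\infty(x+z-d,S')\mid S=s]\bigr\}=\min_{\max(0,d-x)\le z\le\tilde z_{\max}(s)}\bigl\{c(z,s)+\tilde g_\infty(x+z,s)\bigr\}$$ for all $x\in[0,\infty)$, $s\in\mathcal{S}$, and the minimum on the right-hand side is achieved by $$z_\infty^*(x,s):=\begin{cases}\tilde z_{k-1}(s),&\text{if }b_{\infty,k}(s)-\tilde z_{k-1}(s)<x\le b_{\infty,k-1}(s)-\tilde z_{k-1}(s),\ k\in\{0,1,\ldots,K\},\\ b_{\infty,k}(s)-x,&\text{if }b_{\infty,k}(s)-\tilde z_k(s)<x\le b_{\infty,k}(s)-\tilde z_{k-1}(s),\ k\in\{0,1,\ldots,K-1\},\\ b_{\infty,K}(s)-x,&\text{if }b_{\infty,K}(s)-\tilde z_{\max}(s)<x\le b_{\infty,K}(s)-\tilde z_{K-1}(s),\\ \tilde z_{\max}(s),&\text{if }0\le x\le b_{\infty,K}(s)-\tilde z_{\max}(s).\end{cases}$$ (f) The optimal stationary policy for the infinite horizon discounted expected cost problem is $\boldsymbol{\pi}_\infty^*=(z_\infty^*,z_\infty^*,\ldots)$.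
   Context: Time is discrete and indexed backwards: in an $N$-slot problem, $n=N,N-1,\ldots,1$ is the number of slots remaining. The channel condition process $\{S_n\}$ is a finite-state ergodic homogeneous Markov chain with state space $\mathcal{S}$, unaffected by the scheduling decisions. $P>0$ is the power available per slot and $d>0$ is the number of packets removed from the receiver buffer at the end of each slot. Transmitting $z\ge0$ packets (a real number) under channel condition $s$ consumes power $$c(z,s)=z\,\tilde c_0(s)+\sum_{k=0}^{K-1}\bigl(\tilde c_{k+1}(s)-\tilde c_k(s)\bigr)\max\{z-\tilde z_k(s),0\},$$ where $0<\tilde c_0(s)\le\tilde c_1(s)\le\cdots\le\tilde c_K(s)$ and $0=\tilde z_{-1}(s)<\tilde z_0(s)<\cdots<\tilde z_{K-1}(s)<\tilde z_K(s)=\infty$. Let $\tilde z_{\max}(s)$ be the unique $z$ with $c(z,s)=P$; it is assumed that $\tilde z_{\max}(s)\ge d$ and $\tilde z_{\max}(s)>\tilde z_{K-1}(s)$ for all $s\in\mathcal{S}$. The holding cost function $h:[0,\infty)\to[0,\infty)$ is convex and nondecreasing, with $h(0)=0$ and $\lim_{x\to\infty}h(x)=\infty$. At the beginning of slot $n$ the scheduler observes the buffer level $X_n=x\ge0$ and channel condition $S_n=s$ and chooses the number $Z_n=z$ of packets to transmit subject to $\max(0,d-x)\le z\le\tilde z_{\max}(s)$. Then $X_{n-1}=X_n+Z_n-d$. For a (history-dependent, possibly randomized) policy $\boldsymbol{\pi}$, $J^{\boldsymbol\pi}_{N,\alpha}:=\mathbb{E}^{\boldsymbol\pi}\bigl[\sum_{t=1}^N\alpha^{N-t}\{c(Z_t,S_t)+h(X_t+Z_t-d)\}\bigr]$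 given the initial state. The infinite horizon discounted expected cost problem is to minimize $\lim_{N\to\infty}J^{\boldsymbol\pi}_{N,\alpha}$ over all such policies. The finite horizon value functions are $V_0(x,s)=0$ and, for $n=1,2,\ldots$, $$V_n(x,s)=\min_{\max(0,d-x)\le z\le\tilde z_{\max}(s)}\{c(z,s)+\tilde g_n(x+z,s)\},\qquad\tilde g_n(y,s):=h(y-d)+\alpha\,\mathbb{E}[V_{n-1}(y-d,S_{n-1})\mid S_n=s],\ y\in[d,\infty).$$ The finite horizon critical numbers are $b_{n,-1}(s):=\infty$ and, for $k\in\{0,\ldots,K\}$, $$b_{n,k}(s):=\max\Bigl\{d,\inf\{b:\tilde g_n^{\prime+}(b,s)\ge-\tilde c_k(s)\}\Bigr\},$$ with $\tilde g_n^{\prime+}(\cdot,s)$ the right derivative of $\tilde g_n(\cdot,s)$ on $[d,\infty)$; the infima are over $b\in[d,\infty)$. *)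

(* Defs.v *)
From HB Require Import structures.
From mathcomp Require Import all_boot all_order all_algebra.
From mathcomp Require Import all_classical all_reals all_analysis.

Set Implicit Arguments.
Unset Strict Implicit.
Unset Printing Implicit Defensive.

Import Order.TTheory GRing.Theory Num.Theory.
Import numFieldNormedType.Exports.

Local Open Scope classical_set_scope.
Local Open Scope ring_scope.

#[short(type=finMeasurableType)]
HB.structure Definition FinMeasurable (dS : measure_display) :=
  {S of Finite S & Measurable dS S}.

Section markov_chain.
Context (R : realType) (S : finType).
Implicit Types (p : S -> S -> R) (s t : S).

Definition stochastic p : Prop :=
  (forall s t, 0 <= p s t) /\ (forall s, \sum_t p s t = 1).

Fixpoint nstep p (n : nat) s t : R :=
  if n is m.+1 then \sum_u p s u * nstep p m u t else (s == t)%:R.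

Definition irreducible p : Prop := forall s t, exists n, 0 < nstep p n s t.

Definition aperiodic p : Prop := forall s (g : nat),
  (forall n, (0 < n)%N -> 0 < nstep p n s s -> (g %| n)%N) -> g = 1%N.

Definition ergodic p : Prop := irreducible p /\ aperiodic p.

End markov_chain.

Definition minimum (R : realType) (A : set R) (m : R) : Prop :=
  A m /\ lbound A m.

(* The limit is taken in \bar R: the right derivative of a convex function at
   the left end point of its domain may be -oo. *)
Definition right_derivative (R : realType) (f : R -> R) (b : R) : \bar R :=
  lim (((f y - f b) / (y - b))%:E @[y --> b^'+]).

(* The breakpoint of index k (k < K) is [brk k s]; the conventional value
   -1 of the index is handled by [breakpoint] below, and the breakpoint of
   index K is infinite, hence not recorded. *)
Record power_data (R : realType) (S : Type) := PowerData {
  nbrk : nat;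
  slope : nat -> S -> R;
  brk : nat -> S -> R }.

Definition power (R : realType) (S : Type) (D : power_data R S)
    (z : R) (s : S) : R :=
  z * slope D 0 s +
  \sum_(k < nbrk D)
    (slope D k.+1 s - slope D k s) * Num.max (z - brk D k s) 0.

Definition breakpoint (R : realType) (S : Type) (D : power_data R S)
    (k : int) (s : S) : R :=
  if k is Posz j then brk D j s else 0.

Record model (R : realType) (dS : measure_display)
    (S : finMeasurableType dS) := Model {
  trans : S -> S -> R;
  budget : R;
  demand : R;
  curve : power_data R S;
  zmax : S -> R;
  hold : R -> R; (* constrained and used on [0, +oo[ only *)
  channel_discrete : forall A : set S, measurable A;
  trans_stochastic : stochastic trans;
  trans_ergodic : ergodic trans;
  budget_gt0 : 0 < budget;
  demand_gt0 : 0 < demand;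
  slope_gt0 : forall s, 0 < slope curve 0 s;
  slope_le : forall s k, (k < nbrk curve)%N ->
    slope curve k s <= slope curve k.+1 s;
  breakpoint_lt : forall s k, (k < nbrk curve)%N ->
    breakpoint curve (k%:Z - 1) s < breakpoint curve k%:Z s;
  (* power _ s is strictly increasing, so this determines zmax *)
  power_zmax : forall s, power curve (zmax s) s = budget;
  demand_le_zmax : forall s, demand <= zmax s;
  breakpoint_lt_zmax : forall s,
    breakpoint curve ((nbrk curve)%:Z - 1) s < zmax s;
  hold_ge0 : forall x, 0 <= x -> 0 <= hold x;
  hold_convex : convex_function (`[0, +oo[%classic : set R) hold;
  hold_nondecreasing : {in `[0, +oo[ &, {homo hold : x y / x <= y}};
  hold0 : hold 0 = 0;
  hold_pinfty : hold x @[x --> +oo] --> +oo }.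

Section scheduling.
Context (R : realType) (dS : measure_display) (S : finMeasurableType dS).
Variables (M : model R S) (alpha : R).

Let d := demand M.
Let K := nbrk (curve M).
Let c (z : R) (s : S) : R := power (curve M) z s.
Let zt (k : int) (s : S) : R := breakpoint (curve M) k s.

Definition feasible (x : R) (s : S) : set R :=
  `[Num.max 0 (d - x), zmax M s]%classic.

Definition gtilde (V : R -> S -> R) (y : R) (s : S) : R :=
  hold M (y - d) + alpha * \sum_(t : S) trans M s t * V (y - d) t.

(* For x >= 0 the infimum is over a nonempty compact interval and is attained. *)
Fixpoint value (n : nat) (x : R) (s : S) : R :=
  if n is m.+1
  then inf [set c z s + gtilde (value m) (x + z) s | z in feasible x s]
  else 0.

(* Meaningful for n >= 1; index 0 is a dummy repeating index 1. *)
Definition gfin (n : nat) : R -> S -> R := gtilde (value n.-1).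

Definition value_inf (x : R) (s : S) : R := limn (fun n => value n x s).

Definition ginf : R -> S -> R := gtilde value_inf.

Definition critical (g : R -> S -> R) (k : int) (s : S) : \bar R :=
  if k is Posz j then
    Order.max d%:E (ereal_inf [set b%:E | b in
      [set b : R | d <= b /\
        ((- slope (curve M) j s)%:E <= right_derivative (g ^~ s) b)%E]])
  else +oo%E.

Definition bfin (n : nat) : int -> S -> \bar R := critical (gfin n).

Definition binf : int -> S -> \bar R := critical ginf.

Definition zstar_spec (x : R) (s : S) (z : R) : Prop :=
  [\/ exists k : nat,
        [/\ (k <= K)%N, z = zt (k%:Z - 1) s,
            (binf k s - (zt (k%:Z - 1) s)%:E < x%:E)%E &
            (x%:E <= binf (k%:Z - 1) s - (zt (k%:Z - 1) s)%:E)%E],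
      exists k : nat,
        [/\ (k < K)%N, z%:E = (binf k s - x%:E)%E,
            (binf k s - (zt k s)%:E < x%:E)%E &
            (x%:E <= binf k s - (zt (k%:Z - 1) s)%:E)%E],
      [/\ z%:E = (binf K s - x%:E)%E,
          (binf K s - (zmax M s)%:E < x%:E)%E &
          (x%:E <= binf K s - (zt (K%:Z - 1) s)%:E)%E] |
      [/\ z = zmax M s, 0 <= x & (x%:E <= binf K s - (zmax M s)%:E)%E]].

Definition zstar (x : R) (s : S) : R := xget 0 (zstar_spec x s).

(* [history t] gathers the initial state and, for each of the first t slots,
   the transmitted quantity and the next channel condition; the intermediate
   buffer levels are functions of these data, see [level].  Here t counts
   elapsed slots: with N slots in total, it is slot n = N - t. *)
Fixpoint history_display (t : nat) : measure_display :=
  if t is u.+1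
  then ((history_display u, (R.-ocitv.-measurable).-sigma).-prod, dS).-prod%mdisp
  else ((R.-ocitv.-measurable).-sigma, dS).-prod%mdisp.

Fixpoint history (t : nat) : measurableType (history_display t) :=
  match t return measurableType (history_display t) with
  | 0 => (measurableTypeR R * S)%type
  | u.+1 => (history u * measurableTypeR R * S)%type
  end.

Fixpoint level (t : nat) : history t -> R :=
  match t return history t -> R with
  | 0 => fun h => h.1
  | u.+1 => fun h => level h.1.1 + h.1.2 - d
  end.

Definition channel (t : nat) : history t -> S :=
  match t return history t -> S with
  | 0 => fun h => h.2
  | u.+1 => fun h => h.2
  end.

Record policy := Policy {
  rule : forall t, R.-pker (history t) ~> measurableTypeR R;
  rule_feasible : forall t (h : history t), 0 <= level h ->
    rule t h (feasible (level h) (channel h)) = 1%E }.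

(* Discounted cost of the first t slots: alpha ^+ (N - n) with n = N - u is
   alpha ^+ u. *)
Fixpoint total_cost (t : nat) : history t -> R :=
  match t return history t -> R with
  | 0 => fun=> 0
  | u.+1 => fun h =>
      total_cost h.1.1 +
      alpha ^+ u * (c h.1.2 (channel h.1.1) +
                    hold M (level h.1.1 + h.1.2 - d))
  end.

(* [expect pi t f h0] is the expectation of f(history after t slots) under pi
   from the initial state h0, as an iterated integral: the transmitted quantity
   is drawn from the policy (which is concentrated on the feasible set), then
   the next channel condition from the transition matrix. *)
Fixpoint expect (pi : policy) (t : nat) :
    (history t -> \bar R) -> history 0 -> \bar R :=
  match t return (history t -> \bar R) -> history 0 -> \bar R with
  | 0 => fun f => f
  | u.+1 => fun f => expect pi (fun h : history u =>
      \int[rule pi u h]_(z in feasible (level h) (channel h))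
        \sum_(s : S) (trans M (channel h) s)%:E * f (h, z, s))%E
  end.

Definition cost (pi : policy) (N : nat) (x : R) (s : S) : \bar R :=
  expect pi (fun h : history N => (total_cost h)%:E) (x, s).

Definition cost_inf (pi : policy) (x : R) (s : S) : \bar R :=
  limn (fun N => cost pi N x s).

(* Optimality is with respect to every initial state. *)
Definition optimal (pi : policy) : Prop :=
  forall pi' x s, 0 <= x -> (cost_inf pi x s <= cost_inf pi' x s)%E.

Definition stationary_for (pi : policy) (zeta : R -> S -> R) : Prop :=
  forall t (h : history t), 0 <= level h ->
  forall A, measurable A ->
    rule pi t h A = \d_(zeta (level h) (channel h) : measurableTypeR R) A.

End scheduling.

(* Main.v *)
(* For a convex g on [d, +oo) that grows to +oo and satisfies
   g x <= g y + L (y - x) for x <= y, the critical number of index k is the least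
   minimizer of g(y) + c~_k y, and a subgradient argument shows that the modified
   base-stock rule minimizes c(z, s) + g(x + z). The one-sided Lipschitz bound,
   convexity and nonnegativity are preserved by the Bellman operator: from a lower
   level one can copy the decisions made from a higher one, except that the missing
   packets must be transmitted once, at a marginal cost of at most L. The value
   functions increase with n and are bounded by the cost of transmitting d packets
   per slot.

   Pointwise convergence of convex functions alone does not make the critical
   numbers converge from above. What saves (d) is that V_{n+1} - V_n is
   nonincreasing on [0, n d] (a submodularity argument), so that
   g_oo - g_n is nonincreasing on [d, n d], and the least minimizers of
   g_n + c~_k y are at most that of g_oo + c~_k y once n d exceeds the latter.
   The optimality equation follows since the finite-horizon optimal decisions
   converge with the critical numbers.

   For (f), any policy costs at least V_N over N slots, while the optimality
   equation bounds the cost of the stationary policy by V_oo. *)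

Require Import Defs.
From mathcomp Require Import all_boot all_order all_algebra.
From mathcomp Require Import all_classical all_reals all_analysis.
From mathcomp Require Import measurable_realfun.
From mathcomp Require Import zify ring lra.

Set Implicit Arguments.
Unset Strict Implicit.
Unset Printing Implicit Defensive.

Import Order.TTheory GRing.Theory Num.Theory.
Import numFieldNormedType.Exports.

Local Open Scope classical_set_scope.
Local Open Scope ring_scope.

(** * Convex functions on a half-line, their least minimizers and right derivatives *)

Section half_line_convexity.
Context (R : realType).
Implicit Types (f g : R -> R) (a x y z : R).

Definition convex_from a f := forall x y t, a <= x -> a <= y -> 0 <= t <= 1 ->
  f (t * x + (1 - t) * y) <= t * f x + (1 - t) * f y.

Lemma convex_fromP a f :
  convex_function (`[a, +oo[%classic : set R) f <-> convex_from a f.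
Proof.
split=> [cf x y t ax ay /andP[t0 t1]|cf t x y].
  have := cf (Itv01 t0 t1) x y; rewrite !inE/= !in_itv/= !andbT.
  by move=> /(_ ax ay); rewrite /conv/= /unstable.onem.
rewrite !inE/= !in_itv/= !andbT => ax ay.
have := cf x y t%:num ax ay; rewrite /conv/= /unstable.onem; apply.
by apply/andP; split.
Qed.

Lemma convex_from_affineD a f c b :
  convex_from a f -> convex_from a (fun y => f y + c * y + b).
Proof. by move=> cf x y t ax ay t01; have := cf x y t ax ay t01; nra. Qed.

(** Comparison of adjacent chord slopes, multiplied out to avoid division. *)
Lemma convex_from_slope a f x y z : convex_from a f ->
  a <= x -> x < y -> y < z -> (f y - f x) * (z - y) <= (f z - f y) * (y - x).
Proof.
move=> cf ax xy yz; have xz : 0 < z - x by lra.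
have t01 : 0 <= (z - y) / (z - x) <= 1.
  by rewrite divr_ge0 ?ler_pdivrMr//; lra.
have az : a <= z by lra.
have := cf x z _ ax az t01.
have zx0 : z - x != 0 by lra.
have -> : (z - y) / (z - x) * x + (1 - (z - y) / (z - x)) * z = y by field.
rewrite -(ler_pM2r xz).
have -> : ((z - y) / (z - x) * f x + (1 - (z - y) / (z - x)) * f z) * (z - x)
        = (z - y) * f x + (y - x) * f z by field.
nra.
Qed.

Lemma convex_from_ndec a f x y u v : convex_from a f ->
  a <= x -> x < y -> f x <= f y -> y <= u -> u <= v -> f u <= f v.
Proof.
move=> cf ax xy fxy.
have step w : y <= w -> f y <= f w.
  rewrite le_eqVlt => /predU1P[->//|yw].
  by have := convex_from_slope cf ax xy yw; nra.
move=> yu; rewrite le_eqVlt => /predU1P[->//|uv].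
have := step _ yu; move: yu uv; rewrite le_eqVlt => /predU1P[<- yv _|yu uv fyu].
  by apply: step; exact: ltW.
by have := convex_from_slope cf (_ : a <= y) yu uv; nra.
Qed.

(** Bounds only how fast [f] can fall; in particular a convex [f] cannot jump down just after
    [a]. *)
Definition lower_lipschitz a (L : R) f :=
  forall x y, a <= x -> x <= y -> f x <= f y + L * (y - x).

Definition least_argmin a f b := [/\ a <= b,
  forall y, a <= y -> f b <= f y & forall y, a <= y -> y < b -> f b < f y].

Lemma least_argmin_ndec a f b x y : convex_from a f -> least_argmin a f b ->
  b <= x -> x <= y -> f x <= f y.
Proof.
move=> cf [ab minb _]; rewrite le_eqVlt => /predU1P[<- by_|bx xy].
  by apply: minb; lra.
by apply: (convex_from_ndec cf ab bx (minb _ _)) => //; lra.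
Qed.

(** A strict rise before [b] would persist up to [b] by convexity, against the strict minimality of
    [b] over the points on its left. *)
Lemma least_argmin_ninc a f b x y : convex_from a f -> least_argmin a f b ->
  a <= x -> x <= y -> y <= b -> f y <= f x.
Proof.
move=> cf [ab minb strict] ax xy; rewrite le_eqVlt => /predU1P[->|yb].
  exact: minb.
have [//|fxy] := leP (f y) (f x).
have {}xy : x < y by rewrite lt_neqAle xy andbT; apply: contraTneq fxy => ->; rewrite ltxx.
have := convex_from_ndec cf ax xy (ltW fxy) (lexx _) (ltW yb).
by have := strict y ltac:(lra) yb; lra.
Qed.

Definition ndec_from a f := [set b | a <= b /\ forall y, b < y -> f b <= f y].

(** The Lipschitz bound carries the defining property of the set to its infimum [b], and convexity
    makes every point left of [b] strictly worse. *)
Lemma least_argmin_inf a L f : convex_from a f -> lower_lipschitz a L f ->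
  (exists2 y, a < y & f a <= f y) ->
  ndec_from a f !=set0 /\ least_argmin a f (inf (ndec_from a f)).
Proof.
move=> cf lf [y0 ay0 fy0].
set A := ndec_from a f; set b := inf A.
have A0 : A !=set0.
  exists y0; split=> [|y y0y]; first exact: ltW.
  by apply: (convex_from_ndec cf (lexx a) ay0) => //; exact: ltW.
have lbA : lbound A a by move=> x [].
have hlA : has_inf A by split=> //; exists a.
have ab : a <= b by exact: lb_le_inf.
have Ab y : b < y -> f b <= f y.
  move=> by_; have [//|fyb] := leP (f b) (f y).
  pose L' := `|L| + 1; have L0 : 0 < L' by rewrite /L'; have := normr_ge0 L; lra.
  (* A point of [A] within [e] of [b] lies before [y], and [f] falls by less than [f b - f y] on the
     way to it. *)
  pose e := Num.min (y - b) ((f b - f y) / L').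
  have e0 : 0 < e by rewrite lt_min subr_gt0 by_/= divr_gt0//; lra.
  have [x [ax Ax] xb] : exists2 x, A x & x < b + e by exact: inf_adherent.
  have bx : b <= x by apply: ge_inf => //; exists a.
  have xe1 : x < y by have := ge_min (y - b) (y - b) ((f b - f y) / L'); rewrite lexx /= -/e; lra.
  have xe2 : (x - b) * L' < f b - f y.
    rewrite -ltr_pdivlMr//; have : e <= (f b - f y) / L' by rewrite ge_min lexx orbT.
    by lra.
  have := Ax _ xe1; have := lf b x ab bx.
  have : L * (x - b) <= (x - b) * L'.
    by rewrite mulrC ler_wpM2l ?subr_ge0// /L'; have := ler_norm L; lra.
  lra.
have Ab' y : b <= y -> f b <= f y by rewrite le_eqVlt => /predU1P[->//|/Ab].
have strict y : a <= y -> y < b -> f b < f y.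
  move=> ay yb; have [//|fyb] := ltP (f b) (f y); exfalso.
  have nA w : w < b -> ~ A w.
    by move=> wb Aw; have : b <= w by [apply: ge_inf => //; exists a]; lra.
  have [u yu fuy] : exists2 u, y < u & f u < f y.
    apply: contrapT => H; apply: (nA y yb); split=> // u yu.
    by have [//|fuy] := leP (f y) (f u); case: H; exists u.
  have ub : u < b by have [//|/Ab'] := ltP u b; lra.
  have wu w : u < w -> w < b -> f w <= f u.
    move=> uw wb; have [//|fuw] := leP (f w) (f u); case: (nA w wb).
    split=> [|v wv]; first by lra.
    by apply: (convex_from_ndec cf _ uw (ltW fuw)) => //; lra.
  have C0 := Ab (b + 1) ltac:(lra).
  (* Just left of [b] the function stays at least [D] below [f b]. By convexity this jump within a
     distance [e] forces a rise of at least [D / e] over [[b, b + 1]], and the choice of [e] makes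
     that exceed the actual rise [C]. *)
  pose C := f (b + 1) - f b; pose D := f b - f u.
  have D0 : 0 < D by rewrite /D; lra.
  have CD : 0 < 2 * (C + 1) by rewrite /C; lra.
  pose e := Num.min ((b - u) / 2) (D / (2 * (C + 1))).
  have e0 : 0 < e by rewrite lt_min !divr_gt0//; lra.
  have e1 : e <= (b - u) / 2 by rewrite ge_min lexx.
  have e2 : e * (2 * (C + 1)) <= D by rewrite -ler_pdivlMr// ge_min lexx orbT.
  have := convex_from_slope cf (_ : a <= b - e) (_ : b - e < b) (_ : b < b + 1).
  move=> /(_ ltac:(lra) ltac:(lra) ltac:(lra)).
  have := wu (b - e) ltac:(lra) ltac:(lra).
  have : f (b + 1) = C + f b by rewrite /C; ring.
  have : f u = f b - D by rewrite /D; ring.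
  have : 0 <= C by rewrite /C; lra.
  by move=> ? -> -> ?; nra.
split=> //; split=> // y ay.
by have [/strict/ltW|/Ab'] := ltP y b; auto.
Qed.

(** The difference quotients at [b] are nondecreasing, so the right derivative is their infimum,
    possibly [-oo], and a lower bound on it bounds every quotient. *)
Lemma right_derivative_geP a f b (c : R) : convex_from a f -> a <= b ->
  (c%:E <= right_derivative f b)%E <->
  forall y, b < y -> f b + c * (y - b) <= f y.
Proof.
move=> cf ab.
have nd : {in Interval (BRight b) +oo%O &,
    nondecreasing_fun (fun y => ((f y - f b) / (y - b))%:E)}.
  move=> x y; rewrite !in_itv/= !andbT => bx b_y xy; rewrite lee_fin.
  move: xy; rewrite le_eqVlt => /predU1P[->//|xy].
  rewrite ler_pdivrMr ?subr_gt0// mulrAC ler_pdivlMr ?subr_gt0//.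
  by have := convex_from_slope cf ab bx xy; nra.
have -> : right_derivative f b =
    ereal_inf [set ((f y - f b) / (y - b))%:E | y in `]b, +oo[].
  apply/cvg_lim => //.
  exact: nondecreasing_at_right_cvge nd.
split=> [h y b_y|h].
  have : (c%:E <= ((f y - f b) / (y - b))%:E)%E.
    apply: (le_trans h); apply: ereal_inf_lbound; exists y => //=.
    by rewrite in_itv/= b_y.
  by rewrite lee_fin ler_pdivlMr ?subr_gt0//; lra.
apply: le_ereal_inf_tmp => _ [y /= + <-]; rewrite in_itv/= andbT => b_y.
by rewrite lee_fin ler_pdivlMr ?subr_gt0//; have := h _ b_y; lra.
Qed.

End half_line_convexity.

(** * The piecewise-linear power curve and base-stock transmission *)

Section power_curve.
Context (R : realType) (dS : measure_display) (S : finMeasurableType dS).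
Variable M : model R S.
Implicit Types (s : S) (x y z : R) (b : nat -> R).

Let d := demand M.
Let K := nbrk (curve M).
Let c z s := power (curve M) z s.
Let sl := slope (curve M).

(* The breakpoints of the paper with the index shifted by one and the
   infinite last one replaced by [zmax]: z~_{k-1} for k <= K, then z~_max. *)
Definition knot (k : nat) s : R :=
  if k is j.+1 then (if (j < K)%N then brk (curve M) j s else zmax M s) else 0.
Arguments knot : simpl never.

Lemma breakpoint_pred k s : (k <= K)%N ->
  breakpoint (curve M) (k%:Z - 1) s = knot k s.
Proof.
case: k => [//|k kK]; have -> : k.+1%:Z - 1 = k%:Z by lia.
by rewrite /knot kK.
Qed.

Lemma breakpoint_knot k s : (k < K)%N ->
  breakpoint (curve M) k%:Z s = knot k.+1 s.
Proof. by move=> kK; rewrite /knot kK. Qed.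

Lemma knot_lt k s : (k <= K)%N -> knot k s < knot k.+1 s.
Proof.
rewrite leq_eqVlt => /predU1P[->|kK]; last first.
  have := breakpoint_lt s kK.
  by rewrite breakpoint_knot// breakpoint_pred// ltnW.
have := breakpoint_lt_zmax M s; rewrite -/K breakpoint_pred//.
by rewrite [knot K.+1 s]/knot ltnn.
Qed.

Lemma knot_le j k s : (j <= k)%N -> (k <= K.+1)%N -> knot j s <= knot k s.
Proof.
elim: k => [|k IH]; first by rewrite leqn0 => /eqP->.
rewrite leq_eqVlt => /predU1P[->//|jk] kK.
by apply: le_trans (IH jk (ltnW kK)) (ltW (knot_lt _ _)).
Qed.

Lemma knot_ge0 k s : (k <= K.+1)%N -> 0 <= knot k s.
Proof. exact: (@knot_le 0). Qed.

Lemma knot_last s : knot K.+1 s = zmax M s.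
Proof. by rewrite /knot ltnn. Qed.

Lemma slope_homo j k s : (j <= k)%N -> (k <= K)%N -> sl j s <= sl k s.
Proof.
elim: k => [|k IH]; first by rewrite leqn0 => /eqP->.
rewrite leq_eqVlt => /predU1P[->//|jk] kK.
by apply: le_trans (IH jk (ltnW kK)) _; exact: slope_le.
Qed.

Lemma slope_pos k s : (k <= K)%N -> 0 < sl k s.
Proof. by move=> kK; apply: lt_le_trans (slope_gt0 M s) (slope_homo _ _ kK). Qed.

Lemma slope_telescope k s : (k <= K)%N ->
  \sum_(j < K | (j < k)%N) (sl j.+1 s - sl j s) = sl k s - sl 0%N s.
Proof.
move=> kK; rewrite -(big_ord_widen K (fun j => sl j.+1 s - sl j s) kK).
by rewrite -(big_mkord xpredT (fun j => sl j.+1 s - sl j s)) telescope_sumr.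
Qed.

Lemma power_sub z z' s : c z' s - c z s = (z' - z) * sl 0%N s +
  \sum_(j < K) (sl j.+1 s - sl j s) *
     (Num.max (z' - brk (curve M) j s) 0 - Num.max (z - brk (curve M) j s) 0).
Proof.
rewrite /c /power -/K -/sl opprD addrACA -mulrBl -sumrB; congr (_ + _).
by apply: eq_bigr => j _; rewrite -mulrBr.
Qed.

(** Beyond knot [k] the linear term and the first [k] ramps grow at total rate [sl k s]; later ramps
    can only add. *)
Lemma power_slope_ge k z z' s : (k <= K)%N -> knot k s <= z -> z <= z' ->
  sl k s * (z' - z) <= c z' s - c z s.
Proof.
move=> kK kz zz'; rewrite power_sub.
have -> : sl k s * (z' - z) = (z' - z) * sl 0%N s +
    \sum_(j < K | (j < k)%N) (sl j.+1 s - sl j s) * (z' - z).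
  by rewrite -big_distrl/= slope_telescope//; ring.
rewrite lerD2l big_mkcond/=; apply: ler_sum => j _.
have dj : 0 <= sl j.+1 s - sl j s by rewrite subr_ge0; exact: slope_le.
case: ltnP => jk; last first.
  by rewrite mulr_ge0// subr_ge0 ge_max !le_max lexx orbT; lra.
rewrite ler_wpM2l//.
have : brk (curve M) j s <= z.
  apply: le_trans kz; rewrite -[leLHS]/(breakpoint (curve M) j%:Z s).
  by rewrite breakpoint_knot ?knot_le// ltnW.
by move=> jz; rewrite !max_l; lra.
Qed.

(** Ramps from index [k] on vanish up to [z], and earlier ones grow at rate at most one. The bound
    on [z] is conditional because the last segment has no right end. *)
Lemma power_slope_le k z z' s : (k <= K)%N ->
  ((k < K)%N -> z <= knot k.+1 s) -> z' <= z ->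
  c z s - c z' s <= sl k s * (z - z').
Proof.
move=> kK kz zz'; rewrite power_sub.
have -> : sl k s * (z - z') = (z - z') * sl 0%N s +
    \sum_(j < K | (j < k)%N) (sl j.+1 s - sl j s) * (z - z').
  by rewrite -big_distrl/= slope_telescope//; ring.
rewrite lerD2l [leRHS]big_mkcond/=; apply: ler_sum => j _.
have dj : 0 <= sl j.+1 s - sl j s by rewrite subr_ge0; exact: slope_le.
case: ltnP => jk.
  rewrite ler_wpM2l// lerBlDr ge_max.
  set m := Num.max (z' - _) 0.
  have m1 : z' - brk (curve M) j s <= m by rewrite le_max lexx.
  have m2 : 0 <= m by rewrite le_max lexx orbT.
  by apply/andP; split; lra.
have : z <= brk (curve M) j s.
  apply: le_trans (kz (leq_ltn_trans jk (ltn_ord j))) _.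
  rewrite -[leRHS]/(breakpoint (curve M) j%:Z s) breakpoint_knot//.
  by rewrite knot_le// ltnW// ltnS.
by move=> jz; rewrite !max_r ?subrr ?mulr0//; lra.
Qed.

Lemma power_lipschitz z z' s : z <= z' -> c z' s - c z s <= sl K s * (z' - z).
Proof. by apply: power_slope_le => //; rewrite ltnn. Qed.

Lemma power_homo z z' s : 0 <= z -> z <= z' -> c z s <= c z' s.
Proof.
move=> z0 zz'; rewrite -subr_ge0.
apply: le_trans (power_slope_ge (leq0n K) _ zz') => //.
by rewrite mulr_ge0 ?subr_ge0// ltW// slope_pos.
Qed.

Lemma power_ge0 z s : 0 <= z -> 0 <= c z s.
Proof.
move=> z0; apply: addr_ge0; first by rewrite mulr_ge0// ltW// slope_pos.
apply: sumr_ge0 => j _.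
by rewrite mulr_ge0 ?le_max ?lexx ?orbT// subr_ge0; exact: slope_le.
Qed.

Lemma power_demand_le s : c d s <= budget M.
Proof.
by rewrite -(power_zmax M s) power_homo ?demand_le_zmax// ltW// demand_gt0.
Qed.

Lemma power_convex x y t s : 0 <= t <= 1 ->
  c (t * x + (1 - t) * y) s <= t * c x s + (1 - t) * c y s.
Proof.
move=> /andP[t0 t1]; rewrite /c /power -/K -/sl !mulrDr addrACA.
apply: lerD; first by rewrite le_eqVlt; apply/orP; left; apply/eqP; ring.
rewrite !mulr_sumr -big_split/=; apply: ler_sum => j _.
have dj : 0 <= sl j.+1 s - sl j s by rewrite subr_ge0; exact: slope_le.
rewrite (mulrCA t) (mulrCA (1 - t)) -mulrDr ler_wpM2l// ge_max; set b := brk _ _ _.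
have max_ge (u : R) : u <= Num.max u 0 /\ 0 <= Num.max u 0 by rewrite !le_max !lexx orbT.
have [? ?] := max_ge (x - b); have [? ?] := max_ge (y - b).
by apply/andP; split; nra.
Qed.

(** The four cases of the optimal rule, merged into two by treating [zmax] as knot [K.+1]. The
    guards drop the lower bound at the last knot and the upper bound at the first, where the
    critical number of index -1 is infinite. *)
Definition base_stock_spec b x s z : Prop :=
  (exists k : nat, [/\ (k <= K.+1)%N, z = knot k s,
     (k <= K)%N -> b k - knot k s < x & (0 < k)%N -> x <= b k.-1 - knot k s]) \/
  (exists k : nat, [/\ (k <= K)%N, z = b k - x,
     b k - knot k.+1 s < x & x <= b k - knot k s]).

(* A closed form of the solution of [base_stock_spec]: segment k of the power
   curve is filled as far as the base-stock level b k allows. It makes the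
   dependence on b and x visibly continuous. *)
Definition base_stock b x s : R := \sum_(k < K.+1)
  Num.max 0 (Num.min (b k - x - knot k s) (knot k.+1 s - knot k s)).

Definition antitone_upto b := forall j k, (j <= k)%N -> (k <= K)%N -> b k <= b j.

(** Segments below [k] are full and those above are empty, so the sum telescopes to [knot k s];
    segment [k] adds nothing in the first case and [b k - x - knot k s] in the second. *)
Lemma base_stock_spec_unique b x s z : antitone_upto b ->
  base_stock_spec b x s z -> z = base_stock b x s.
Proof.
move=> hb.
have full j k : (j < k <= K.+1)%N -> x <= b k.-1 - knot k s ->
    Num.max 0 (Num.min (b j - x - knot j s) (knot j.+1 s - knot j s)) =
    knot j.+1 s - knot j s.
  move=> /andP[jk kK] xb.
  have bj : b k.-1 <= b j by apply: hb; [rewrite -ltnS prednK//; lia|lia].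
  have jk' : knot j.+1 s <= knot k s by exact: knot_le.
  have : knot j s <= knot j.+1 s by apply: knot_le => //; lia.
  by move=> ?; rewrite min_r ?max_r; lra.
have none j k : (k <= j <= K)%N -> b k - knot k s <= x ->
    Num.max 0 (Num.min (b j - x - knot j s) (knot j.+1 s - knot j s)) = 0.
  move=> /andP[kj jK] xb; apply/max_l; rewrite ge_min; apply/orP; left.
  have := hb _ _ kj jK; have : knot k s <= knot j s by apply: knot_le => //; lia.
  by lra.
have telescope k : (k <= K.+1)%N ->
    \sum_(j < K.+1 | (j < k)%N) (knot j.+1 s - knot j s) = knot k s.
  move=> kK; rewrite -(big_ord_widen K.+1 (fun j => knot j.+1 s - knot j s) kK).
  rewrite -(big_mkord xpredT (fun j => knot j.+1 s - knot j s)).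
  by rewrite telescope_sumr// subr0.
move=> [[k [kK -> bk kb]]|[k [kK -> bk kb]]].
  rewrite -telescope// /base_stock [LHS]big_mkcond/=; apply: eq_bigr => j _.
  case: ltnP => jk; first by rewrite (full j k) ?jk//; apply: kb; lia.
  by rewrite (none j k)//; [have := ltn_ord j; lia|apply/ltW/bk; have := ltn_ord j; lia].
rewrite /base_stock (bigD1 (Ordinal (kK : (k < K.+1)%N)))//=.
rewrite min_l; last by lra.
rewrite max_r; last by lra.
rewrite -[LHS](subrK (knot k s)) -{2}telescope; last by lia.
congr (_ + _); rewrite [LHS]big_mkcond [RHS]big_mkcond/=; apply: eq_bigr => j _.
case: ltngtP => [jk|jk|jk].
- rewrite (full j k)//; first by rewrite -val_eqE/= ltn_eqF.
  + by apply/andP; split => //; lia.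
  + have : b k <= b k.-1 by apply: hb; lia.
    by lra.
- rewrite -val_eqE/= gtn_eqF// (none j k.+1)//; first by have := ltn_ord j; lia.
  have : b k.+1 <= b k by apply: hb; have := ltn_ord j; lia.
  by lra.
- by rewrite -val_eqE/= jk eqxx.
Qed.

(** Take the least [k] whose lower bound holds, with [K.+1] as a sentinel. The failure of this bound
    at [k.-1] leaves just the two cases. *)
Lemma base_stock_spec_exists b x s : exists z, base_stock_spec b x s z.
Proof.
pose P k := (k == K.+1) || (b k - knot k s < x).
have exP : exists k, P k by exists K.+1; rewrite /P eqxx.
case: (ex_minnP exP) => k Pk mink.
have kK : (k <= K.+1)%N by apply: mink; rewrite /P eqxx.
have bk : (k <= K)%N -> b k - knot k s < x.
  by move=> {}kK; move: Pk; rewrite /P ltn_eqF.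
have [k0|k0] := posnP k.
  by exists (knot k s); left; exists k; split=> //; rewrite k0.
have [xb|bx] := leP x (b k.-1 - knot k s).
  by exists (knot k s); left; exists k; split.
exists (b k.-1 - x); right; exists k.-1; rewrite prednK//; split => //; first by lia.
have [//|bk'] := leP x (b k.-1 - knot k.-1 s).
have : (k <= k.-1)%N by apply: mink; rewrite /P bk' orbT.
by lia.
Qed.

Lemma base_stockP b x s : antitone_upto b -> base_stock_spec b x s (base_stock b x s).
Proof.
move=> hb; have [z /[dup] hz] := base_stock_spec_exists b x s.
by move=> /(base_stock_spec_unique hb) <-.
Qed.

(** * One-slot optimality of the base-stock rule *)

Section optimal_transmission.
Variables (g : R -> R) (b : nat -> R) (s : S).
Hypothesis cg : convex_from d g.
Hypothesis argmin_b : forall k, (k <= K)%N ->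
  least_argmin d (fun y => g y + sl k s * y) (b k).

(** A steeper linear term moves the least minimizer to the left: if [b j < b k], the two minimality
    inequalities add up to a contradiction with [sl j s <= sl k s]. *)
Lemma argmin_antitone : antitone_upto b.
Proof.
move=> j k jk kK; have := slope_homo s jk kK => sjk.
have [_ minj _] := argmin_b (leq_trans jk kK); have [dk _ ltk] := argmin_b kK.
have [//|bjk] := leP (b k) (b j).
have dj : d <= b j by have [] := argmin_b (leq_trans jk kK).
by have := minj _ dk; have := ltk _ dj bjk; nra.
Qed.

(** At a knot, sending more costs at least slope [k], and [g] tilted by that slope no longer falls
    beyond [b k]; sending less saves at most slope [k.-1], and [g] tilted by it does not rise before
    [b k.-1]. Inside a segment, [x + z] is the minimizer [b k] and [sl k s] is a subgradient of the
    power at [z]. *)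
Lemma base_stock_optimal x z : 0 <= x -> base_stock_spec b x s z ->
  feasible M x s z /\ (forall z', feasible M x s z' ->
    c z s + g (x + z) <= c z' s + g (x + z')).
Proof.
have cG k : convex_from d (fun y => g y + sl k s * y).
  have := convex_from_affineD (sl k s) 0 cg; congr convex_from.
  by apply/funext => y; rewrite addr0.
have feasE z' : feasible M x s z' -> [/\ 0 <= z', d <= x + z' & z' <= zmax M s].
  rewrite /feasible/= -/d in_itv/= ge_max => /andP[/andP[z0 dz] zm]; split => //; lra.
have d0 : 0 < d := demand_gt0 M; have dm : d <= zmax M s := demand_le_zmax M s.
move=> x0 [[k [kK -> bk kb]]|[k [kK -> bk kb]]].
  have db : d <= x + knot k s.
    have [kK'|kK'] := leqP k K.
      by have [dbk _ _] := argmin_b kK'; have := bk kK'; lra.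
    by have -> : k = K.+1 by [lia]; rewrite knot_last; lra.
  have km : knot k s <= zmax M s by rewrite -knot_last; exact: knot_le.
  split.
    by rewrite /feasible/= -/d in_itv/= ge_max km knot_ge0// andbT/=; lra.
  move=> z' /feasE[z'0 dz' zm'].
  have [kz'|kz'] := leP (knot k s) z'.
    have [kK'|kK'] := leqP k K.
      have := power_slope_ge kK' (lexx (knot k s)) kz'.
      have := least_argmin_ndec (cG k) (argmin_b kK') (x := x + knot k s) (y := x + z').
      have := bk kK' => ? H; have hA : b k <= x + knot k s by lra.
      have hB : x + knot k s <= x + z' by lra.
      by have /= := H hA hB; lra.
    (* Here [k] is [K.+1], so the knot is [zmax M s] and no larger [z'] is feasible. *)
    suff -> : z' = knot k s by [].
    apply/eqP; rewrite eq_le kz' andbT; suff <- : K.+1 = k by rewrite knot_last.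
    by apply/eqP; rewrite eqn_leq kK kK'.
  have k0 : (0 < k)%N by rewrite lt0n; apply: contraTneq kz' => ->; rewrite -leNgt.
  have kK' : (k.-1 <= K)%N by rewrite -ltnS prednK.
  have := power_slope_le (z := knot k s) (z' := z') (s := s) kK'.
  rewrite prednK// => /(_ (fun=> lexx _) (ltW kz')).
  have := least_argmin_ninc (cG k.-1) (argmin_b kK') (x := x + z') (y := x + knot k s).
  by have := kb k0 => ? /(_ ltac:(lra) ltac:(lra) ltac:(lra)) /=; lra.
have [dbk minb _] := argmin_b kK.
have k0 : 0 <= knot k s by apply: knot_ge0; lia.
have km : knot k.+1 s <= zmax M s by rewrite -knot_last; exact: knot_le.
split.
  by rewrite /feasible/= -/d in_itv/= ge_max -!andbA; apply/and3P; split; lra.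
move=> z' /feasE[z'0 dz' zm'].
have /= := minb _ dz'.
have -> : x + (b k - x) = b k by ring.
have [bz|bz] := leP (b k - x) z'.
  by have := power_slope_ge kK (_ : knot k s <= b k - x) bz => /(_ ltac:(lra)); lra.
have := power_slope_le (z := b k - x) (z' := z') (s := s) kK.
by move=> /(_ (fun=> ltac:(lra)) (ltW bz)); lra.
Qed.

End optimal_transmission.

End power_curve.

(** * The Bellman operator and the bounds it preserves *)

Section bellman_operator.
Context (R : realType) (dS : measure_display) (S : finMeasurableType dS).
Variables (M : model R S) (alpha : R).
Hypotheses (alpha_ge0 : 0 <= alpha) (alpha_lt1 : alpha < 1).
Implicit Types (s t : S) (x y z : R) (V W : R -> S -> R).

Let d := demand M.
Let K := nbrk (curve M).
Let c z s := power (curve M) z s.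
Let sl := slope (curve M).
Let h := hold M.
Let d0 : 0 < d := demand_gt0 M.

Definition mean (f : S -> R) s := \sum_t trans M s t * f t.

Lemma mean_le (f f' : S -> R) s : (forall t, f t <= f' t) -> mean f s <= mean f' s.
Proof.
have [p0 _] := trans_stochastic M.
by move=> ff'; apply: ler_sum => t _; rewrite ler_wpM2l.
Qed.

Lemma mean_cst (a : R) s : mean (fun=> a) s = a.
Proof. by have [_ p1] := trans_stochastic M; rewrite /mean -big_distrl/= p1 mul1r. Qed.

Lemma meanD (f f' : S -> R) s : mean (fun t => f t + f' t) s = mean f s + mean f' s.
Proof. by rewrite -big_split/=; apply: eq_bigr => t _; rewrite mulrDr. Qed.

Lemma meanZ (a : R) (f : S -> R) s : mean (fun t => a * f t) s = a * mean f s.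
Proof. by rewrite mulr_sumr; apply: eq_bigr => t _; rewrite mulrCA. Qed.

Lemma mean_ge0 (f : S -> R) s : (forall t, 0 <= f t) -> 0 <= mean f s.
Proof. by move=> f0; rewrite -(mean_cst 0 s); apply: mean_le. Qed.

Lemma hold_le x y : 0 <= x -> x <= y -> h x <= h y.
Proof.
by move=> x0 xy; apply: hold_nondecreasing; rewrite // in_itv/= andbT//; lra.
Qed.

Lemma hold_large (A : R) : exists N : R, forall y, N < y -> A <= h y.
Proof.
have /cvgryPge/(_ A)[N [_ hN]] := hold_pinfty M.
by exists N => y /hN.
Qed.

(** The sum is a convenient bound on marginal power cost, uniform in the channel condition. *)
Definition maxslope : R := \sum_s sl K s.
Let L := maxslope.

Lemma slope_maxslope s : sl K s <= L.
Proof.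
by rewrite /L /maxslope (bigD1 s)//= lerDl sumr_ge0// => t _; rewrite ltW// slope_pos.
Qed.

Lemma maxslope_ge0 : 0 <= L.
Proof. by apply: sumr_ge0 => t _; rewrite ltW// slope_pos. Qed.

Definition good_post (g : R -> R) := [/\ convex_from d g, lower_lipschitz d L g &
  forall A, exists2 y, d < y & A <= g y].

Definition good_value V := forall s, [/\ convex_from 0 (V ^~ s),
  lower_lipschitz 0 L (V ^~ s) & forall x, 0 <= x -> 0 <= V x s].

Definition threshold (g : R -> S -> R) s (k : nat) : R := fine (critical M g k%:Z s).

(** The set defining the critical number is [ndec_from] of [g] tilted by slope [k], whose infimum is
    the least minimizer. In particular [fine] in [threshold] loses nothing. *)
Lemma critical_least_argmin (g : R -> S -> R) s k : good_post (g ^~ s) -> (k <= K)%N ->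
  critical M g k%:Z s = (threshold g s k)%:E /\
  least_argmin d (fun y => g y s + sl k s * y) (threshold g s k).
Proof.
move=> [cg lg coer] kK; have sk : 0 < sl k s by exact: slope_pos.
set G := fun y => g y s + sl k s * y.
have cG : convex_from d G.
  have := convex_from_affineD (sl k s) 0 cg; congr convex_from.
  by apply/funext => y; rewrite addr0.
have lG : lower_lipschitz d L G.
  by move=> x y dx xy; have := lg x y dx xy; rewrite /G; nra.
have [G0 lB] : ndec_from d G !=set0 /\ least_argmin d G (inf (ndec_from d G)).
  apply: least_argmin_inf cG lG _; have [y dy gy] := coer (G d).
  by exists y => //; apply: le_trans gy _; rewrite /G lerDl mulr_ge0 ?ltW// (lt_trans d0).
suff E : critical M g k%:Z s = (inf (ndec_from d G))%:E by rewrite /threshold E.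
rewrite /critical.
have -> : [set b | d <= b /\ ((- sl k s)%:E <= right_derivative (g ^~ s) b)%E]
    = ndec_from d G.
  apply/seteqP; split=> b [db hb]; split => //.
    by move=> y b_y; have /(_ y b_y) := (right_derivative_geP _ cg db).1 hb; rewrite /G; lra.
  apply/(right_derivative_geP _ cg db) => y b_y.
  by have := hb y b_y; rewrite /G; lra.
rewrite ereal_inf_EFin//; last by exists d => x [].
by apply/max_idPr; rewrite lee_fin; case: lB.
Qed.

Lemma gtildeE V y s : gtilde M alpha V y s = h (y - d) + alpha * mean (V (y - d)) s.
Proof. by []. Qed.

(** Averaging keeps convexity, discounting shrinks the Lipschitz constant to [alpha * L], and the
    holding cost alone grows without bound. *)
Lemma good_post_gtilde V s : good_value V -> good_post ((gtilde M alpha V) ^~ s).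
Proof.
move=> gV; split=> [x y t dx dy t01|x y dx xy|A].
- rewrite !gtildeE.
  have xd : 0 <= x - d by lra.
  have yd : 0 <= y - d by lra.
  have -> : t * x + (1 - t) * y - d = t * (x - d) + (1 - t) * (y - d) by ring.
  have /convex_fromP ch := hold_convex M.
  have h1 := ch _ _ _ xd yd t01.
  have h2 : mean (V (t * (x - d) + (1 - t) * (y - d))) s <=
      mean (fun u => t * V (x - d) u + (1 - t) * V (y - d) u) s.
    by apply: mean_le => u; have [cV _ _] := gV u; exact: cV.
  move: h2; rewrite meanD !meanZ => h2; have := ler_wpM2l alpha_ge0 h2.
  by rewrite -/h in h1; lra.
- rewrite !gtildeE.
  have h1 : h (x - d) <= h (y - d) by apply: hold_le; lra.
  have h2 : mean (V (x - d)) s <= mean (fun u => V (y - d) u + L * (y - x)) s.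
    apply: mean_le => u; have [_ lV _] := gV u.
    have -> : y - x = y - d - (x - d) by ring.
    by apply: lV; lra.
  move: h2; rewrite meanD mean_cst => h2.
  have a1 : 0 <= 1 - alpha by rewrite subr_ge0 ltW.
  have xy' : 0 <= y - x by lra.
  have := mulr_ge0 a1 (mulr_ge0 maxslope_ge0 xy').
  by have := ler_wpM2l alpha_ge0 h2; rewrite -/L; lra.
- have [N hN] := hold_large A; exists (d + `|N| + 1).
    by have := normr_ge0 N; lra.
  rewrite !gtildeE.
  have N1 : N < d + `|N| + 1 - d by have := ler_norm N; lra.
  have := hN _ N1; suff : 0 <= alpha * mean (V (d + `|N| + 1 - d)) s by lra.
  rewrite mulr_ge0// mean_ge0// => u; have [_ _ ->//] := gV u.
  by have := normr_ge0 N; lra.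
Qed.

(** [value] at [n.+1] is convertible to this operator applied to [value] at [n]. *)
Definition bellman V x s : R :=
  inf [set c z s + gtilde M alpha V (x + z) s | z in feasible M x s].

Lemma feasibleP x s z : 0 <= x ->
  feasible M x s z <-> [/\ 0 <= z, d <= x + z & z <= zmax M s].
Proof.
rewrite /feasible/= -/d in_itv/= ge_max => x0; split.
  by move=> /andP[/andP[z0 dz] zm]; split => //; lra.
by move=> [-> ? ->]; rewrite andbT/=; lra.
Qed.

Lemma threshold_optimal (g : R -> S -> R) x s z : good_post (g ^~ s) -> 0 <= x ->
  base_stock_spec M (threshold g s) x s z ->
  feasible M x s z /\ (forall z', feasible M x s z' ->
    c z s + g (x + z) s <= c z' s + g (x + z') s).
Proof.
move=> gg; have [cg _ _] := gg; apply: (@base_stock_optimal _ _ _ M (g ^~ s)) => //.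
by move=> k kK; have [] := critical_least_argmin gg kK.
Qed.

Lemma threshold_antitone (g : R -> S -> R) s : good_post (g ^~ s) ->
  antitone_upto M (threshold g s).
Proof.
move=> gg; have [cg _ _] := gg; apply: (@argmin_antitone _ _ _ _ (g ^~ s) _ s).
by move=> k kK; have [] := critical_least_argmin gg kK.
Qed.

(** The base-stock quantity attains the infimum, so later arguments can compare decisions instead of
    infima. *)
Lemma bellmanP V x s : good_value V -> 0 <= x ->
  let z := base_stock M (threshold (gtilde M alpha V) s) x s in
  [/\ feasible M x s z, bellman V x s = c z s + gtilde M alpha V (x + z) s &
    forall z', feasible M x s z' ->
      bellman V x s <= c z' s + gtilde M alpha V (x + z') s].
Proof.
move=> gV x0 z; have gg := good_post_gtilde s gV.
have [fz minz] : feasible M x s z /\ (forall z', feasible M x s z' ->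
    c z s + gtilde M alpha V (x + z) s <= c z' s + gtilde M alpha V (x + z') s).
  apply: threshold_optimal => //; apply: base_stockP.
  exact: threshold_antitone.
suff E : bellman V x s = c z s + gtilde M alpha V (x + z) s by rewrite E.
apply/eqP; rewrite eq_le; apply/andP; split.
  apply: ge_inf; last by exists z.
  by exists (c z s + gtilde M alpha V (x + z) s) => _ [z' /minz ? <-].
apply: lb_le_inf; first by exists (c z s + gtilde M alpha V (x + z) s); exists z.
by move=> _ [z' /minz ? <-].
Qed.

Lemma gtilde_le V W y s : (forall x t, 0 <= x -> V x t <= W x t) -> d <= y ->
  gtilde M alpha V y s <= gtilde M alpha W y s.
Proof.
by move=> VW dy; rewrite lerD2l ler_wpM2l// mean_le// => t; apply: VW; rewrite subr_ge0.
Qed.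

Lemma gtilde_ge0 V y s : good_value V -> d <= y -> 0 <= gtilde M alpha V y s.
Proof.
move=> gV dy; have yd : 0 <= y - d by lra.
apply: addr_ge0; first exact: hold_ge0.
by rewrite mulr_ge0// -/(mean _ _) mean_ge0// => t; have [_ _ ->] := gV t.
Qed.

Lemma bellman_le V W x s : good_value V -> good_value W ->
  (forall x t, 0 <= x -> V x t <= W x t) -> 0 <= x -> bellman V x s <= bellman W x s.
Proof.
move=> gV gW VW x0; have [fz -> _] := bellmanP s gW x0.
have [_ _ /(_ _ fz)] := bellmanP s gV x0 => /le_trans; apply.
rewrite lerD2l; apply: gtilde_le => //.
by have /(feasibleP _ _ x0)[] := fz.
Qed.

(** For convexity, a mixture of optimal decisions is feasible at the mixed level. For the Lipschitz
    bound, the decision at the higher level is copied unless it leaves fewer than [d] packets. *)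
Lemma good_value_bellman V : good_value V -> good_value (bellman V).
Proof.
move=> gV s; split=> [x y t x0 y0 /[dup] t01 /andP[t0 t1]|x y x0 xy|x x0].
- have [cg _ _] := good_post_gtilde s gV.
  have [fzx -> _] := bellmanP s gV x0; have [fzy -> _] := bellmanP s gV y0.
  move: fzx fzy; set zx := base_stock _ _ x s; set zy := base_stock _ _ y s.
  move=> /(feasibleP _ _ x0)[? ? ?] /(feasibleP _ _ y0)[? ? ?].
  have xy0 : 0 <= t * x + (1 - t) * y by nra.
  have [_ _ /(_ (t * zx + (1 - t) * zy))] := bellmanP s gV xy0.
  have fz : feasible M (t * x + (1 - t) * y) s (t * zx + (1 - t) * zy).
    by apply/feasibleP => //; split; nra.
  move=> /(_ fz) /le_trans; apply.
  have -> : t * x + (1 - t) * y + (t * zx + (1 - t) * zy) =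
            t * (x + zx) + (1 - t) * (y + zy) by ring.
  have := @power_convex _ _ _ M zx zy t s t01; rewrite -!/(c _ s).
  have := cg (x + zx) (y + zy) t ltac:(done) ltac:(done) t01.
  by lra.
- have y0 : 0 <= y by lra.
  have [_ lg _] := good_post_gtilde s gV.
  have dm : d <= zmax M s := demand_le_zmax M s.
  have [fz -> _] := bellmanP s gV y0.
  move: fz; set z := base_stock _ _ y s => /(feasibleP _ _ y0)[z0 dz zm].
  have [_ _ bx] := bellmanP s gV x0.
  have L0 := maxslope_ge0; rewrite -/L in L0.
  have Ls := slope_maxslope s.
  have [dxz|dxz] := leP d (x + z).
    have /bx /le_trans : feasible M x s z by apply/feasibleP.
    apply; have := lg (x + z) (y + z) dxz ltac:(lra).
    have -> : y + z - (x + z) = y - x by ring.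
    by lra.
  (* Sending [d - x] instead of [z] costs at most [L * (d - x - z)] more, and ending at [d] instead
     of [y + z] at most [L * (y + z - d)]; together this is [L * (y - x)]. *)
  have /bx /le_trans : feasible M x s (d - x) by apply/feasibleP => //; split; lra.
  apply; have -> : x + (d - x) = d by ring.
  have := lg d (y + z) (lexx _) dz.
  have := @power_lipschitz _ _ _ M z (d - x) s ltac:(lra); rewrite -!/(c _ s) -/sl -/K.
  by nra.
- have [fz -> _] := bellmanP s gV x0.
  move/(feasibleP _ _ x0) : fz => [z0 dz zm].
  by rewrite addr_ge0 ?power_ge0 ?gtilde_ge0.
Qed.

Lemma good_value_value n : good_value (value M alpha n).
Proof.
elim: n => [|n IH]; last exact: good_value_bellman.
move=> s; split=> [x y t _ _ _|x y _ xy|//]; first by rewrite !mulr0 addr0.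
by rewrite add0r mulr_ge0 ?maxslope_ge0// subr_ge0.
Qed.

Lemma value_leS n x s : 0 <= x -> value M alpha n x s <= value M alpha n.+1 x s.
Proof.
elim: n x s => [|n IH] x s x0.
  by have [_ _ ->] := @good_value_value 1 s.
apply: (@bellman_le (value M alpha n) (value M alpha n.+1)) => //;
  exact: good_value_value.
Qed.

Lemma value_ndec x s : 0 <= x -> nondecreasing_seq (fun n => value M alpha n x s).
Proof. by move=> x0; apply/nondecreasing_seqP => n; exact: value_leS. Qed.

(* Transmitting exactly [d] packets in every slot keeps the level constant. *)
Lemma value_le n x s : 0 <= x -> value M alpha n x s <= (budget M + h x) / (1 - alpha).
Proof.
have a1 : 0 < 1 - alpha by rewrite subr_gt0.
move=> x0; have hx : 0 <= h x by exact: hold_ge0.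
have B0 : 0 < budget M := budget_gt0 M.
have d_ge0 := ltW d0.
elim: n s => [|n IH] s; first by rewrite divr_ge0//; lra.
have dm : d <= zmax M s := demand_le_zmax M s.
have [_ _ /(_ d)] := bellmanP s (good_value_value n) x0.
have fd : feasible M x s d by apply/feasibleP => //; split; lra.
move=> /(_ fd) /le_trans; apply; rewrite gtildeE.
have -> : x + d - d = x by ring.
set U := _ / (1 - alpha).
(* [U] is the discounted cost of paying [budget M + h x] in every slot forever. *)
have UE : U = budget M + h x + alpha * U by rewrite /U; field; rewrite lt0r_neq0.
have /(ler_wpM2l alpha_ge0) : mean (value M alpha n x) s <= U.
  by rewrite -[leRHS](mean_cst _ s); apply: mean_le => t; apply: IH.
have := power_demand_le M s; rewrite -/d -/(c _ _).
by lra.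
Qed.

Lemma value_cvg x s : 0 <= x -> value M alpha n x s @[n --> \oo] --> value_inf M alpha x s.
Proof.
move=> x0; apply: nondecreasing_is_cvgn; first exact: value_ndec.
by exists ((budget M + h x) / (1 - alpha)) => _ [n _ <-]; exact: value_le.
Qed.

Lemma value_le_inf n x s : 0 <= x -> value M alpha n x s <= value_inf M alpha x s.
Proof.
move=> x0; apply: nondecreasing_cvgn_le; first exact: value_ndec.
by apply/cvg_ex; eexists; exact: value_cvg.
Qed.

Lemma value_inf_le x s a : 0 <= x ->
  (forall n, value M alpha n x s <= a) -> value_inf M alpha x s <= a.
Proof.
move=> x0 va; apply: limr_le; first by apply/cvg_ex; eexists; exact: value_cvg.
exact: nearW.
Qed.

Lemma good_value_inf : good_value (value_inf M alpha).
Proof.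
move=> s; split=> [x y t x0 y0 /[dup] t01 /andP[t0 t1]|x y x0 xy|x x0].
- apply: value_inf_le => [|n]; first by nra.
  have [cV _ _] := good_value_value n s.
  apply: le_trans (cV _ _ _ x0 y0 t01) _.
  by apply: lerD; rewrite ler_wpM2l ?value_le_inf//; lra.
- apply: value_inf_le => // n; have [_ lV _] := good_value_value n s.
  by apply: le_trans (lV _ _ x0 xy) _; rewrite lerD2r value_le_inf//; lra.
- exact: (@value_le_inf 0).
Qed.

End bellman_operator.

(** * Convergence of the critical numbers *)

Section critical_number_limit.
Context (R : realType) (dS : measure_display) (S : finMeasurableType dS).
Variables (M : model R S) (alpha : R).
Hypotheses (alpha_ge0 : 0 <= alpha) (alpha_lt1 : alpha < 1).
Implicit Types (s t : S) (x y z : R) (V W : R -> S -> R).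

Let d := demand M.
Let K := nbrk (curve M).
Let c z s := power (curve M) z s.
Let sl := slope (curve M).
Let h := hold M.
Let d0 : 0 < d := demand_gt0 M.
Let v n := value M alpha n.
Let vgood n : good_value M (v n) := good_value_value M alpha_ge0 alpha_lt1 n.

Lemma power0 s : c 0 s = 0.
Proof.
apply/eqP; rewrite eq_le power_ge0// andbT.
rewrite -[leRHS](subrr (c 0 s)) -[leRHS]opprK opprB.
rewrite /c /power mul0r add0r subrr oppr0 big1// => j _.
rewrite max_r ?mulr0// sub0r oppr_le0 -[brk _ _ _]/(breakpoint (curve M) j%:Z s).
by rewrite breakpoint_knot// knot_ge0// ltnW// ltnS.
Qed.

(** The level [x] already covers the demand of all [m] slots, so sending nothing is possible, and a
    lower level only saves holding cost. *)
Lemma value_ndec_level m s x y : m%:R * d <= x -> x <= y -> v m x s <= v m y s.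
Proof.
elim: m s x y => [|m IH] s x y mx xy; first by rewrite /v/=.
have d_gt0 := d0.
have md : 0 <= m%:R * d by rewrite mulr_ge0// ltW.
move: mx; rewrite -natr1 mulrDl mul1r => mx.
have gnd u w : m%:R * d + d <= u -> u <= w ->
    gtilde M alpha (v m) u s <= gtilde M alpha (v m) w s.
  move=> mu uw; apply: lerD; first by apply: hold_le; rewrite -/d; lra.
  by rewrite ler_wpM2l//; apply: mean_le => t; apply: IH; rewrite -/d; lra.
have x0 : 0 <= x by lra.
have y0 : 0 <= y by lra.
have zm : 0 <= zmax M s by apply: le_trans (ltW d0) (demand_le_zmax M s).
have [_ _ /(_ 0)] := bellmanP alpha_ge0 alpha_lt1 s (vgood m) x0.
have /[swap] /[apply] : feasible M x s 0 by apply/feasibleP => //; split => //; rewrite -/d; lra.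
rewrite -/(c 0 s) power0 add0r addr0 => /le_trans; apply.
have [+ E _] := bellmanP alpha_ge0 alpha_lt1 s (vgood m) y0.
rewrite [leRHS]E; set z := base_stock _ _ _ _ => /(feasibleP _ _ _ y0)[z0 _ _].
by rewrite -[leLHS]add0r lerD ?power_ge0// gnd//; lra.
Qed.

(** The holding cost cancels, and the demand shifts the range [[0, m d]] of the hypothesis to
    [[d, (m+1) d]]. The hypothesis is explicit so that the lemma serves both inside and after the
    induction proving it. *)
Lemma gtilde_diff_ninc m s x y :
  (forall s x y, 0 <= x -> x <= y -> y <= m%:R * d ->
    v m.+1 y s - v m y s <= v m.+1 x s - v m x s) ->
  d <= x -> x <= y -> y <= m.+1%:R * d ->
  gtilde M alpha (v m.+1) y s - gtilde M alpha (v m) y s <=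
  gtilde M alpha (v m.+1) x s - gtilde M alpha (v m) x s.
Proof.
rewrite -natr1 mulrDl mul1r => IH dx xy ym; rewrite !gtildeE -/d.
have : mean M (v m.+1 (y - d)) s + mean M (v m (x - d)) s <=
       mean M (v m.+1 (x - d)) s + mean M (v m (y - d)) s.
  rewrite -!meanD; apply: mean_le => t.
  by have := IH t (x - d) (y - d) ltac:(lra) ltac:(lra) ltac:(lra); lra.
by move=> /(ler_wpM2l alpha_ge0); lra.
Qed.

(* With m slots to go, a packet above the level m d is never needed, and below
   that level a longer horizon only makes packets more valuable. *)
Lemma value_diff_ninc m s x y : 0 <= x -> x <= y -> y <= m%:R * d ->
  v m.+1 y s - v m y s <= v m.+1 x s - v m x s.
Proof.
elim: m s x y => [|m IH] s x y x0 xy ym.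
  by have -> : x = y by rewrite mul0r in ym; lra.
have y0 : 0 <= y by lra.
set f := gtilde M alpha (v m); set g := gtilde M alpha (v m.+1).
have fg u w : d <= u -> u <= w -> w <= m.+1%:R * d -> g w s - f w s <= g u s - f u s.
  by move=> *; exact: gtilde_diff_ninc.
have [_ _ minfx] := bellmanP alpha_ge0 alpha_lt1 s (vgood m) x0.
have [_ _ mingy] := bellmanP alpha_ge0 alpha_lt1 s (vgood m.+1) y0.
have [+ vgx _] := bellmanP alpha_ge0 alpha_lt1 s (vgood m.+1) x0.
have [+ vfy _] := bellmanP alpha_ge0 alpha_lt1 s (vgood m) y0.
rewrite -[bellman M alpha (v m.+1)]/(v m.+2) -/g in mingy vgx.
rewrite -[bellman M alpha (v m)]/(v m.+1) -/f in minfx vfy.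
rewrite vgx vfy -/(c _ _); set w := base_stock _ _ y s; set z := base_stock _ _ x s.
rewrite -/(c z s).
have {}minfx u : feasible M x s u -> v m.+1 x s <= c u s + f (x + u) s := minfx u.
have {}mingy u : feasible M y s u -> v m.+2 y s <= c u s + g (y + u) s := mingy u.
have d_gt0 := d0.
move=> /(feasibleP _ _ _ y0)[w0]; rewrite -/d => dyw wm.
move=> /(feasibleP _ _ _ x0)[z0]; rewrite -/d => dxz zm.
have md : d <= m.+1%:R * d by rewrite ler_peMl ?ler1n// ltW.
(* f is nondecreasing beyond (m+1) d, so transmitting past that level never pays *)
have [w' [w'0 dyw' w'm yw' w'opt]] : exists w', [/\ 0 <= w', d <= y + w',
    w' <= zmax M s, y + w' <= m.+1%:R * d &
    c w' s + f (y + w') s <= c w s + f (y + w) s].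
  have [yw|yw] := leP (y + w) (m.+1%:R * d); first by exists w; split.
  exists (m.+1%:R * d - y).
  have -> : y + (m.+1%:R * d - y) = m.+1%:R * d by ring.
  split => //; [lra|lra|].
  apply: lerD; first by apply: power_homo; lra.
  rewrite /f !gtildeE -/d; have mdE : m.+1%:R * d = m%:R * d + d by rewrite -natr1; ring.
  have m0 : 0 <= m%:R * d by rewrite mulr_ge0// ltW.
  apply: lerD; first by apply: hold_le; lra.
  by rewrite ler_wpM2l//; apply: mean_le => t; apply: value_ndec_level; rewrite -/d; lra.
suff : v m.+2 y s + v m.+1 x s <= c w' s + f (y + w') s + (c z s + g (x + z) s) by lra.
(* If the levels after transmission are ordered like [x] and [y], each decision stays with its own
   level. *)
have [zw|wz] := leP (x + z) (y + w').
  have Fy : feasible M y s w' by apply/feasibleP.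
  have Fx : feasible M x s z by apply/feasibleP.
  have := mingy _ Fy; have := minfx _ Fx; have := fg _ _ dxz zw yw'.
  by lra.
(* Otherwise the targets are exchanged: [y] moves to [x + z] and [x] to [y + w']. The terms in [f]
   and [g] then cancel and only powers remain. *)
have Fy : feasible M y s (x + z - y) by apply/feasibleP => //; rewrite -/d; split; lra.
have Fx : feasible M x s (y + w' - x) by apply/feasibleP => //; rewrite -/d; split; lra.
have := mingy _ Fy; have := minfx _ Fx.
have -> : y + (x + z - y) = x + z by ring.
have -> : x + (y + w' - x) = y + w' by ring.
suff : c (x + z - y) s + c (y + w' - x) s <= c w' s + c z s by lra.
have wz' : 0 < z - w' by lra.
(* The exchanged quantities lie between [w'] and [z] and have the same sum, so by convexity they
   cost no more. *)
pose t := (y - x) / (z - w').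
have t01 : 0 <= t <= 1 by rewrite /t divr_ge0 ?ler_pdivrMr//; lra.
have zw0 : z - w' != 0 by rewrite lt0r_neq0.
have := @power_convex _ _ _ M w' z t s t01; rewrite -!/(c _ _).
have := @power_convex _ _ _ M z w' t s t01; rewrite -!/(c _ _).
have -> : t * z + (1 - t) * w' = y + w' - x by rewrite /t; field.
have -> : t * w' + (1 - t) * z = x + z - y by rewrite /t; field.
by lra.
Qed.

Lemma gtilde_cvg y s : d <= y ->
  gtilde M alpha (v n) y s @[n --> \oo] --> ginf M alpha y s.
Proof.
move=> dy; apply: cvgD; first exact: cvg_cst.
apply: cvgMl_tmp.
rewrite -[X in _ --> X]/(\sum_(t : S) trans M s t * value_inf M alpha (y - d) t).
apply: cvg_big => [|t _]; first exact: add_continuous.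
by apply: cvgMl_tmp; apply: value_cvg => //; rewrite subr_ge0.
Qed.

Lemma gfin_cvg y s : d <= y -> gfin M alpha n y s @[n --> \oo] --> ginf M alpha y s.
Proof.
move=> dy; rewrite -(cvg_shiftn 1%N).
by under eq_fun do rewrite addn1; exact: gtilde_cvg.
Qed.

Lemma gfin_le m n y s : (m <= n)%N -> d <= y -> gfin M alpha m y s <= gfin M alpha n y s.
Proof.
move=> mn dy; apply: gtilde_le => // x t x0.
by apply: (value_ndec M alpha_ge0 alpha_lt1 t x0); lia.
Qed.

Lemma good_post_gfin n s : good_post M ((gfin M alpha n) ^~ s).
Proof. exact: good_post_gtilde. Qed.

Lemma good_post_ginf s : good_post M ((ginf M alpha) ^~ s).
Proof. by apply: good_post_gtilde => //; exact: good_value_inf. Qed.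

(** The one-step comparisons are chained over all horizons beyond [n], and the bound passes to the
    limit. *)
Lemma ginf_gfin_diff n s x y : (0 < n)%N -> d <= x -> x <= y -> y <= n%:R * d ->
  ginf M alpha y s - ginf M alpha x s <= gfin M alpha n y s - gfin M alpha n x s.
Proof.
case: n => // n _ dx xy yn.
have step p : gfin M alpha (n.+1 + p) y s - gfin M alpha (n.+1 + p) x s <=
    gfin M alpha n.+1 y s - gfin M alpha n.+1 x s.
  elim: p => [|p]; first by rewrite addn0.
  apply: le_trans; rewrite addnS -lerBlDr opprK.
  have := @gtilde_diff_ninc (n + p) s x y (@value_diff_ninc _) dx xy.
  move=> /(_ (le_trans yn _)); rewrite /gfin !addSn/= -!/(v _); set a := gtilde _ _ _ _ _.
  suff /[swap] /[apply] : n.+1%:R * d <= (n + p).+1%:R * d by lra.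
  by apply: ler_wpM2r; [exact: ltW|rewrite ler_nat; lia].
apply: (cvgr_to_le (cvgB (@gfin_cvg y s (le_trans dx xy)) (@gfin_cvg x s dx))).
exists n.+1 => // m /= nm.
by rewrite -(subnKC nm); exact: step.
Qed.

Lemma ginf_pinfty s : ginf M alpha y s @[y --> +oo] --> +oo.
Proof.
apply/cvgryPge => A; have [N hN] := hold_large M A.
exists (`|N| + d); split; first exact: num_real.
move=> y yN; have d_gt0 := d0; have Ny : N < y - d by have := ler_norm N; lra.
have Ny0 : 0 <= y - d by have := normr_ge0 N; lra.
apply: le_trans (hN _ Ny) _; rewrite -/(h (y - d)) /ginf gtildeE lerDl mulr_ge0//.
apply: mean_ge0 => t.
by have [_ _ ->] := good_value_inf M alpha_ge0 alpha_lt1 t.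
Qed.

(** From above, comparing increments with [ginf] gives [bn n <= b] once [n d] exceeds [b]. From
    below, pointwise convergence at [b - e] and [b] suffices, since the tilted limit is strictly
    larger at [b - e]. *)
Lemma threshold_cvg k s : (k <= K)%N ->
  threshold M (gfin M alpha n) s k @[n --> \oo] --> threshold M (ginf M alpha) s k.
Proof.
move=> kK; have [_] := critical_least_argmin (good_post_ginf s) kK.
pose b := threshold M (ginf M alpha) s k; pose G y := ginf M alpha y s + sl k s * y.
move=> argb; have {}argb : least_argmin d G b := argb.
pose bn n := threshold M (gfin M alpha n) s k.
pose Gn n y := gfin M alpha n y s + sl k s * y.
have argbn n : least_argmin d (Gn n) (bn n).
  by have [_] := critical_least_argmin (good_post_gfin n s) kK.
have cGn n : convex_from d (Gn n).
  have [cg _ _] := good_post_gfin n s.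
  have := convex_from_affineD (sl k s) 0 cg; congr convex_from.
  by apply/funext => y; rewrite addr0.
have d_gt0 := d0; have [db minb strictb] := argb.
apply/cvgrPdist_le => e e0.
have up : \forall n \near \oo, bn n <= b.
  near=> n; have bnd : b < n%:R * d.
    by rewrite -ltr_pdivrMr//; near: n; exact: nbhs_infty_gtr.
  have n0 : (0 < n)%N by rewrite lt0n; apply: contraTneq bnd => ->; rewrite mul0r -leNgt (le_trans (ltW d0)).
  have [//|bbn] := leP (bn n) b; have [dbn _ strict] := argbn n.
  (* Increments are comparable only up to [n d], hence the cap; convexity extends the inequality
     from [y] to [bn n], against its strict minimality. *)
  pose y := Num.min (bn n) (n%:R * d).
  have yb : b < y by rewrite lt_min bbn.
  have := ginf_gfin_diff s n0 db (ltW yb) (_ : y <= n%:R * d).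
  rewrite {1}/y ge_min lexx orbT => /(_ isT) dG.
  have Gby : Gn n b <= Gn n y.
    by have := minb y ltac:(lra); rewrite /G /Gn; lra.
  have := convex_from_ndec (cGn n) db yb Gby (lexx _) (_ : y <= bn n).
  rewrite {1}/y ge_min lexx => /(_ isT).
  by move=> /(le_trans Gby) Gbb; have := strict _ db bbn; rewrite ltNge Gbb.
have low : \forall n \near \oo, b - e <= bn n.
  have [dbe|dbe] := leP d (b - e); last first.
    by apply: nearW => n; have [? _ _] := argbn n; lra.
  have GcvgB : (Gn n (b - e) - Gn n b) @[n --> \oo] --> G (b - e) - G b.
    by apply: cvgB; (apply: cvgD; [exact: gfin_cvg|exact: cvg_cst]).
  have G0 : 0 < G (b - e) - G b by rewrite subr_gt0; apply: strictb => //; lra.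
  near=> n; have : 0 < Gn n (b - e) - Gn n b by near: n; exact: (cvgr_gt _ GcvgB).
  move=> Gbe; have [//|bnb] := leP (b - e) (bn n).
  have := least_argmin_ndec (cGn n) (argbn n) (ltW bnb) (_ : b - e <= b).
  by move=> /(_ ltac:(lra)); lra.
apply: filterS2 up low => n.
by rewrite -/(bn n) -/b => ? ?; rewrite ger0_norm; lra.
Unshelve. all: by end_near. Qed.

Lemma critical_cvg k s : -1 <= k <= K%:Z ->
  bfin M alpha n k s @[n --> \oo] --> binf M alpha k s.
Proof.
(* A negative index gives the constant [+oo] for every [n]. *)
case: k => [k|k] /andP[k1 kK]; last exact: cvg_cst.
have {}kK : (k <= K)%N by [].
rewrite /binf (critical_least_argmin (good_post_ginf s) kK).1.
under eq_fun do rewrite /bfin (critical_least_argmin (good_post_gfin _ s) kK).1.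
by apply: cvg_EFin; [exact: nearW|exact: threshold_cvg].
Qed.

End critical_number_limit.

(** * The optimality equation and its minimizer *)

Section optimality_equation.
Context (R : realType) (dS : measure_display) (S : finMeasurableType dS).
Variables (M : model R S) (alpha : R).
Hypotheses (alpha_ge0 : 0 <= alpha) (alpha_lt1 : alpha < 1).
Implicit Types (s t : S) (x y z : R).

Let d := demand M.
Let K := nbrk (curve M).
Let c z s := power (curve M) z s.
Let d0 : 0 < d := demand_gt0 M.
Let v := value M alpha.
Let w := value_inf M alpha.
Let vgood n : good_value M (v n) := good_value_value M alpha_ge0 alpha_lt1 n.
Let wgood : good_value M w := good_value_inf M alpha_ge0 alpha_lt1.

(** Right of [u] this is the Lipschitz hypothesis; left of [u] the chord over [[u, u + 1]] bounds
    the slope. The constant depends on [u], which is enough for a limit at [u]. *)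
Lemma convex_from_locally_lipschitz (a L u : R) (f : R -> R) : convex_from a f ->
  lower_lipschitz a L f -> a <= u ->
  exists C, forall y, a <= y -> f u <= f y + C * `|y - u|.
Proof.
move=> cf lf au; exists (`|L| + `|f (u + 1) - f u|) => y ay.
have [uy|yu] := leP u y.
  rewrite (@ger0_norm _ (y - u)) ?subr_ge0//; apply: le_trans (lf _ _ au uy) _.
  rewrite lerD2l ler_wpM2r ?subr_ge0//.
  by apply: le_trans (ler_norm L) _; rewrite lerDl.
have := convex_from_slope cf ay yu (_ : u < u + 1) => /(_ ltac:(lra)).
have -> : u + 1 - u = 1 by ring.
rewrite (@ltr0_norm _ (y - u)) ?subr_lt0// opprB mulr1 lerBlDl => /le_trans; apply.
rewrite lerD2l ler_wpM2r ?subr_ge0 ?(ltW yu)//.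
by apply: le_trans (ler_norm _) _; rewrite lerDr.
Qed.

Lemma base_stock_cvg (b : nat -> nat -> R) (b' : nat -> R) x s :
  (forall k, (k <= K)%N -> b n k @[n --> \oo] --> b' k) ->
  base_stock M (b n) x s @[n --> \oo] --> base_stock M b' x s.
Proof.
move=> bb'; apply: cvg_big => [|k _]; first exact: add_continuous.
set e := _ - _.
have min_cont : continuous (fun a : R => (Num.min a e : R^o)).
  by move=> a; apply: (@continuous_min R R id (fun=> e)); [exact: cvg_id|exact: cvg_cst].
have clamp_cont : continuous (fun a : R => (Num.max 0 (Num.min a e) : R)).
  move=> a; have := @continuous_max R R (fun=> 0) (fun a => Num.min a e) a.
  by move=> /(_ (cvg_cst _)) /(_ (min_cont a)).
have bk : b n k - x - knot M k s @[n --> \oo] --> b' k - x - knot M k s.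
  apply: cvgB; last exact: cvg_cst.
  by apply: cvgB; [apply: bb'; rewrite -ltnS|exact: cvg_cst].
exact: (cvg_comp _ _ bk (clamp_cont _)).
Qed.

(** One inequality is monotonicity of the operator. For the other, with [m] fixed, [zn n] evaluated
    against [gfin] at [m] costs at most [w x s]; letting [n] grow moves [zn n] to [z], and letting
    [m] grow turns [gfin] into [ginf]. *)
Lemma bellman_value_inf x s : 0 <= x -> bellman M alpha w x s = w x s.
Proof.
move=> x0; apply/eqP; rewrite eq_le; apply/andP; split; last first.
  apply: value_inf_le => // -[|n].
    by have [_ _ ->] := good_value_bellman alpha_ge0 alpha_lt1 wgood s.
  by apply: bellman_le => // y t; exact: value_le_inf.
have gg s' := good_post_ginf M alpha_ge0 alpha_lt1 s'.
pose z := base_stock M (threshold M (ginf M alpha) s) x s.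
have [fz -> _] := bellmanP alpha_ge0 alpha_lt1 s wgood x0; rewrite -/(ginf M alpha) -/z in fz *.
have /(feasibleP _ _ _ x0)[z0 dz zm] := fz; rewrite -/d in dz.
pose zn n := base_stock M (threshold M (gfin M alpha n.+1) s) x s.
have znz : zn n @[n --> \oo] --> z.
  apply: base_stock_cvg => k kK.
  have := @threshold_cvg _ _ _ M alpha alpha_ge0 alpha_lt1 k s kK.
  by rewrite -(cvg_shiftS (fun n => threshold M (gfin M alpha n) s k)).
rewrite -lerBrDl; apply: (cvgr_to_le (@gfin_cvg _ _ _ M alpha alpha_ge0 alpha_lt1 _ s dz)).
apply: nearW => m; rewrite lerBrDl.
have [cg lg _] := good_post_gfin M alpha_ge0 alpha_lt1 m s.
have [C Cg] := convex_from_locally_lipschitz cg lg dz.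
have L0 := maxslope_ge0 M; have Ls := slope_maxslope M s.
set L := maxslope M in L0 Ls.
(* [zn n] is optimal with [n.+1] slots left, and replacing it by [z] costs at most [L + C] per unit
   of distance. *)
have bound n : (m <= n)%N ->
    c z s + gfin M alpha m (x + z) s <= w x s + (L + C) * `|zn n - z|.
  move=> mn; have [+ E _] := bellmanP alpha_ge0 alpha_lt1 s (vgood n) x0.
  move=> /(feasibleP _ _ _ x0); rewrite -[threshold _ _ _]/(threshold M (gfin M alpha n.+1) s).
  rewrite -/(zn n) => -[zn0 dzn znm].
  have := value_le_inf M alpha_ge0 alpha_lt1 n.+1 s x0.
  rewrite -[value M alpha n.+1 x s]/(bellman M alpha (v n) x s) E.
  rewrite -[threshold _ _ _]/(threshold M (gfin M alpha n.+1) s) -/(zn n) -/(c _ _).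
  have := @gfin_le _ _ _ M alpha alpha_ge0 alpha_lt1 m n.+1 (x + zn n) s (leqW mn) dzn.
  rewrite /gfin [n.+1.-1]/= -/(v n) -/(gfin M alpha m) -/w.
  have := Cg _ dzn; have -> : x + zn n - (x + z) = zn n - z by ring.
  have : c z s <= c (zn n) s + L * `|zn n - z|.
    have [zzn|znz'] := leP z (zn n).
      apply: (@le_trans _ _ (c (zn n) s)); first exact: power_homo.
      by rewrite lerDl mulr_ge0.
    rewrite -lerBlDl ltr0_norm ?subr_lt0// opprB.
    apply: le_trans (power_lipschitz M s (ltW znz')) _.
    by rewrite ler_wpM2r// subr_ge0 ltW.
  move=> cz gz gmn vw; apply: le_trans (lerD cz gz) _.
  rewrite addrACA -mulrDl lerD2r; apply: le_trans vw.
  by rewrite lerD2l.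
have dist0 : `|zn n - z| @[n --> \oo] --> `|z - z|.
  by apply: cvg_norm; apply: (cvgB znz); exact: cvg_cst.
rewrite subrr normr0 in dist0.
have lim : w x s + (L + C) * `|zn n - z| @[n --> \oo] --> w x s + (L + C) * 0.
  by apply: cvgD; [exact: cvg_cst|exact: cvgMl_tmp].
rewrite mulr0 addr0 in lim.
by apply: (cvgr_to_ge lim); exists m => // n /= mn; exact: bound.
Qed.

Lemma binfE k s : (k <= K)%N ->
  binf M alpha k%:Z s = (threshold M (ginf M alpha) s k)%:E.
Proof.
by move=> kK; have [] := critical_least_argmin (good_post_ginf M alpha_ge0 alpha_lt1 s) kK.
Qed.

(** The first and fourth cases are the knots up to [K] and the knot [K.+1]; the second and third are
    the segments below [K] and the segment [K]. *)
Lemma zstar_spec_base_stock x s z : 0 <= x ->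
  zstar_spec M alpha x s z <-> base_stock_spec M (threshold M (ginf M alpha) s) x s z.
Proof.
move=> x0; split.
  case=> [[k [kK ->]]|[k [kK]]||[-> _]].
  - rewrite breakpoint_pred// binfE// -!EFinB lte_fin => bk kb.
    left; exists k; split=> //; first exact: leqW.
    case: k kK kb {bk} => // k kK + _.
    have -> : k.+1%:Z - 1 = k%:Z by lia.
    by rewrite binfE ?lee_fin//; exact: ltnW.
  - have kK' := ltnW kK; rewrite breakpoint_pred// breakpoint_knot// binfE// -!EFinB.
    by rewrite lte_fin lee_fin => -[->] bk kb; right; exists k.
  - rewrite breakpoint_pred// binfE// -!EFinB -knot_last lte_fin lee_fin.
    by move=> [[->] bk kb]; right; exists K.
  - rewrite binfE// -EFinB -knot_last lee_fin => kb.
    by left; exists K.+1; split => //; rewrite ltnn.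
case=> [[k [kK -> bk kb]]|[k [kK -> bk kb]]].
  have [{}kK|Kk] := leqP k K.
    apply: Or41; exists k; rewrite breakpoint_pred// binfE// -EFinB lte_fin; split => //.
      exact: bk.
    case: k kK kb {bk} => [|k] kK kb; first by rewrite leey.
    have -> : k.+1%:Z - 1 = k%:Z by lia.
    by rewrite binfE; [rewrite lee_fin; exact: kb|exact: ltnW].
  have {kK Kk}kE : k = K.+1 by lia.
  apply: Or44; rewrite kE knot_last binfE// -EFinB lee_fin; split => //.
  by rewrite kE knot_last in kb; exact: kb.
have [{}kK|Kk] := ltnP k K.
  apply: Or42; exists k; have kK' := ltnW kK.
  by rewrite breakpoint_pred// breakpoint_knot// binfE// -!EFinB lte_fin lee_fin.
have {kK Kk}kE : k = K by lia.
rewrite kE knot_last in bk kb *; apply: Or43.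
by rewrite breakpoint_pred// binfE// -!EFinB lte_fin lee_fin.
Qed.

(** The closed form is visibly measurable in the level, unlike the choice made by [zstar]; the
    channel comes first to allow partial application. *)
Definition stationary_rule s x : R := base_stock M (threshold M (ginf M alpha) s) x s.

Lemma stationary_rule_spec x s : 0 <= x -> zstar_spec M alpha x s (stationary_rule s x).
Proof.
move=> x0; apply/zstar_spec_base_stock => //; apply: base_stockP.
exact/threshold_antitone/good_post_ginf.
Qed.

Lemma zstar_spec_unique x s z : 0 <= x -> zstar_spec M alpha x s z ->
  z = stationary_rule s x.
Proof.
move=> x0 /(zstar_spec_base_stock _ _ x0); apply: base_stock_spec_unique.
exact/threshold_antitone/good_post_ginf.
Qed.

Lemma zstarE x s : 0 <= x -> zstar M alpha x s = stationary_rule s x.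
Proof.
move=> x0; apply: zstar_spec_unique => //.
by apply: (xgetPex 0); exists (stationary_rule s x); exact: stationary_rule_spec.
Qed.

Lemma stationary_ruleP x s : 0 <= x ->
  [/\ feasible M x s (stationary_rule s x),
    w x s = c (stationary_rule s x) s + ginf M alpha (x + stationary_rule s x) s &
    forall z, feasible M x s z -> w x s <= c z s + ginf M alpha (x + z) s].
Proof.
move=> x0; have := bellmanP alpha_ge0 alpha_lt1 s wgood x0.
by rewrite bellman_value_inf.
Qed.

End optimality_equation.

(** * Integral estimates for integrands not known to be measurable *)

Section integral_bounds.
Context (d : measure_display) (T : measurableType d) (R : realType).
Variables (mu : {measure set T -> \bar R}) (D : set T).
Implicit Types f g : T -> \bar R.
Local Open Scope ereal_scope.

Import HBNNSimple.

(* Unlike [ge0_le_integral], this holds without measurability assumptions,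
   the integral of a nonnegative function being a supremum over the simple
   functions below it. *)
Lemma ge0_le_integralW f g : (forall x, D x -> 0 <= f x) ->
  (forall x, D x -> f x <= g x) ->
  \int[mu]_(x in D) f x <= \int[mu]_(x in D) g x.
Proof.
move=> f0 fg; have g0 x : D x -> 0 <= g x.
  by move=> Dx; exact: le_trans (f0 _ Dx) (fg _ Dx).
rewrite !ge0_integralE//; apply: le_ereal_sup => _ [h /= hf <-].
exists h => // x; apply: le_trans (hf x) _; rewrite /patch.
by case: ifPn => // /set_mem; exact: fg.
Qed.

Lemma ge_cst_integral (a : R) f : measurable D -> mu D = 1 -> (0 <= a)%R ->
  (forall x, D x -> a%:E <= f x) -> a%:E <= \int[mu]_(x in D) f x.
Proof.
move=> mD muD a0 af; rewrite -[leLHS]mule1 -muD -integral_cst//.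
by apply: ge0_le_integralW => // x _; rewrite lee_fin.
Qed.

(** A simple function below [f] integrates to its value at [z], hence to at most [f z]. *)
Lemma integral_dirac_le (z : T) f : D z -> (forall x, D x -> 0 <= f x) ->
  \int[\d_z]_(x in D) f x <= f z.
Proof.
move=> Dz f0; rewrite ge0_integralE//; apply: ge_ereal_sup => _ [h /= hf <-].
rewrite -integralT_nnsfun integral_dirac//; last exact/measurable_EFinP.
by rewrite diracT mul1e; apply: le_trans (hf z) _; rewrite patchE mem_set.
Qed.

End integral_bounds.

(** * Expected costs of policies and optimality of the stationary one *)

Section policies.
Context (R : realType) (dS : measure_display) (S : finMeasurableType dS).
Variables (M : model R S) (alpha : R).
Hypotheses (alpha_ge0 : 0 <= alpha) (alpha_lt1 : alpha < 1).
Implicit Types (s : S) (x z : R).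

Let d := demand M.
Let c z s := power (curve M) z s.
Let w := value_inf M alpha.
Let v := value M alpha.

Lemma measurable_channel t : measurable_fun setT (@channel R dS S t).
Proof. by case: t => [|t]; exact: measurable_snd. Qed.

Lemma measurable_level t :
  measurable_fun setT (fun h : history R S t => level M h : measurableTypeR R).
Proof.
elim: t => [|t IH]; first exact: measurable_fst.
apply: measurable_funB; last exact: measurable_cst.
apply: measurable_funD.
  apply: (measurableT_comp IH).
  exact: (measurableT_comp measurable_fst measurable_fst).
exact: (measurableT_comp measurable_snd measurable_fst).
Qed.

Lemma measurable_stationary_rule s : measurable_fun setT
  (stationary_rule M alpha s : measurableTypeR R -> measurableTypeR R).
Proof.
apply: measurable_sum => k.
apply: measurable_maxr; first exact: measurable_cst.
apply: measurable_minr; last exact: measurable_cst.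
apply: measurable_funB; last exact: measurable_cst.
by apply: measurable_funB; [exact: measurable_cst|exact: measurable_id].
Qed.

Definition stationary_action t (h : history R S t) : measurableTypeR R :=
  stationary_rule M alpha (channel h) (level M h).

Lemma measurable_stationary_action t : measurable_fun setT (@stationary_action t).
Proof.
move=> _ A mA; rewrite setTI.
(* The finitely many channel conditions split the preimage into pieces on which the rule depends on
   the level alone. *)
have -> : @stationary_action t @^-1` A = \big[setU/set0]_(s : S)
    ((@channel R dS S t) @^-1` [set s] `&`
     (fun h => stationary_rule M alpha s (level M h)) @^-1` A).
  rewrite -bigcup_seq; apply/seteqP; split=> [h Ah|h [s _ [/= <-]]//].
  by exists (channel h) => //=; rewrite mem_index_enum.
apply: bigsetU_measurable => s _; apply: measurableI; rewrite -[X in measurable X]setTI.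
  by apply: measurable_channel => //; exact: (channel_discrete M).
have := measurableT_comp (measurable_stationary_rule s) (@measurable_level t).
exact.
Qed.

Lemma stationary_rule_feasible t (h : history R S t) : 0 <= level M h ->
  kdirac (R := R) (@measurable_stationary_action t) h
    (feasible M (level M h) (channel h)) = 1%E.
Proof.
move=> h0; rewrite /kdirac/= diracE mem_set//.
by have [] := stationary_ruleP M alpha_ge0 alpha_lt1 (channel h) h0.
Qed.

Definition stationary_policy : policy M :=
  @Policy R dS S M (fun t => kdirac (@measurable_stationary_action t))
    stationary_rule_feasible.

(** [expect] integrates over feasible quantities only, so bounds on these histories carry over to
    expectations. *)
Fixpoint admissible t : history R S t -> Prop :=
  match t return history R S t -> Prop with
  | 0 => fun h => 0 <= h.1
  | u.+1 => fun h => admissible h.1.1 /\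
      feasible M (level M h.1.1) (channel h.1.1) h.1.2
  end.

Lemma admissible_level t (h : history R S t) : admissible h -> 0 <= level M h.
Proof.
elim: t h => [//|t IH] h [/IH h0 /(feasibleP _ _ _ h0)[_ + _]] /=.
by rewrite -subr_ge0.
Qed.

Lemma total_cost_ge0 t (h : history R S t) : admissible h -> 0 <= total_cost M alpha h.
Proof.
elim: t h => [//|t IH] h [ah fh] /=; apply: addr_ge0; first exact: IH.
have h0 := admissible_level ah; have /(feasibleP _ _ _ h0)[z0 dz _] := fh.
by rewrite mulr_ge0 ?exprn_ge0// addr_ge0 ?power_ge0// hold_ge0// subr_ge0.
Qed.

Section fixed_policy.
Variable pi : policy M.
Local Open Scope ereal_scope.

Definition step u (f : history R S u.+1 -> \bar R) (h : history R S u) : \bar R :=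
  \int[rule pi u h]_(z in feasible M (level M h) (channel h))
    \sum_(s : S) (trans M (channel h) s)%:E * f (h, z, s).

Lemma expectS u f h0 : expect pi (t := u.+1) f h0 = expect pi (step f) h0.
Proof. by []. Qed.

Lemma step_ge0 u (f : history R S u.+1 -> \bar R) h : admissible h ->
  (forall h, admissible h -> 0 <= f h) -> 0 <= step f h.
Proof.
have [p0 _] := trans_stochastic M.
move=> ah f0; apply: integral_ge0 => z fz; apply: sume_ge0 => s _.
by rewrite mule_ge0 ?lee_fin// f0.
Qed.

Lemma step_le u (f g : history R S u.+1 -> \bar R) h : admissible h ->
  (forall h, admissible h -> 0 <= f h) -> (forall h, admissible h -> f h <= g h) ->
  step f h <= step g h.
Proof.
have [p0 _] := trans_stochastic M.
move=> ah f0 fg; apply: ge0_le_integralW => z fz.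
  by apply: sume_ge0 => s _; rewrite mule_ge0 ?lee_fin// f0.
by apply: lee_sum => s _; rewrite lee_wpmul2l ?lee_fin// fg.
Qed.

Lemma expect_le t (f g : history R S t -> \bar R) h0 : admissible h0 ->
  (forall h, admissible h -> 0 <= f h) -> (forall h, admissible h -> f h <= g h) ->
  expect pi f h0 <= expect pi g h0.
Proof.
elim: t f g => [|t IH] f g ah0 f0 fg; first exact: fg.
rewrite !expectS; apply: IH => // h ah; first exact: step_ge0.
exact: step_le.
Qed.

(** The process of a verification argument: its expected growth from slot to slot bounds the cost of
    a policy. *)
Definition cost_to_go (V : R -> S -> R) t (h : history R S t) : R :=
  (total_cost M alpha h + alpha ^+ t * V (level M h) (channel h))%R.

Lemma cost_to_go_ge0 V t h : good_value M V -> admissible h ->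
  (0 <= @cost_to_go V t h)%R.
Proof.
move=> gV ah; rewrite addr_ge0 ?total_cost_ge0// mulr_ge0 ?exprn_ge0//.
by have [_ _ ->//] := gV (channel h); exact: admissible_level.
Qed.

Lemma mean_cost_to_go V u (h : history R S u) z :
  \sum_(s : S) (trans M (channel h) s)%:E *
    (@cost_to_go V u.+1 (h, z, s))%:E =
  (total_cost M alpha h + alpha ^+ u *
    (c z (channel h) + gtilde M alpha V (level M h + z) (channel h)))%:E.
Proof.
under eq_bigr do rewrite -EFinM.
rewrite sumEFin; congr EFin.
rewrite -[LHS]/(mean M (fun s => total_cost M alpha h +
   alpha ^+ u * (c z (channel h) + hold M (level M h + z - d)) +
   alpha ^+ u.+1 * V (level M h + z - d) s) (channel h))%R.
rewrite meanD mean_cst meanZ gtildeE exprSr -/d.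
by ring.
Qed.

(** The rule gives the feasible set mass one, and the hypothesis bounds the integrand there, so no
    decision can lower the expected cost-to-go. *)
Lemma step_cost_to_go_ge V V' u (h : history R S u) : good_value M V' ->
  (forall x s z, (0 <= x)%R -> feasible M x s z ->
     (V' x s <= c z s + gtilde M alpha V (x + z) s)%R) ->
  admissible h ->
  (cost_to_go V' h)%:E <= step (fun h' => (cost_to_go V h')%:E) h.
Proof.
move=> gV' V'V ah; have h0 := admissible_level ah.
apply: ge_cst_integral; [exact: measurable_itv|exact: rule_feasible|exact: cost_to_go_ge0|].
move=> z fz; rewrite mean_cost_to_go lee_fin lerD2l ler_wpM2l ?exprn_ge0//.
exact: V'V.
Qed.

(** Peeling off the last slot turns the terminal function [v n] into [v n.+1], hence the induction
    on [t] with [n] free. *)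
Lemma expect_cost_to_go_ge n t (h0 : history R S 0) : admissible h0 ->
  (v (n + t) h0.1 h0.2)%:E <= expect pi (t := t) (fun h => (cost_to_go (v n) h)%:E) h0.
Proof.
move=> ah0; elim: t n => [|t IH] n.
  by rewrite addn0 /= lee_fin /cost_to_go/= add0r mul1r.
have gv m := good_value_value M alpha_ge0 alpha_lt1 m.
rewrite addnS -addSn; apply: le_trans (IH n.+1) _; rewrite expectS.
apply: expect_le => // h ah; first by rewrite lee_fin cost_to_go_ge0.
apply: step_cost_to_go_ge => // x s z x0 fz.
by have [_ _ ->] := bellmanP alpha_ge0 alpha_lt1 s (gv n) x0.
Qed.

Lemma value_le_cost N x s : (0 <= x)%R -> (v N x s)%:E <= cost alpha pi N x s.
Proof.
move=> x0; have := @expect_cost_to_go_ge 0 N (x, s) x0; rewrite add0n => /le_trans; apply.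
apply: expect_le => // h ah; last by rewrite lee_fin /cost_to_go/= mulr0 addr0.
by rewrite lee_fin cost_to_go_ge0//; exact: (good_value_value M alpha_ge0 alpha_lt1 0).
Qed.

(** The step inequality for zero terminal functions: a slot never has negative cost. The limit in
    [cost_inf] is therefore a supremum. *)
Lemma cost_ndec x s : (0 <= x)%R -> nondecreasing_seq (fun N => cost alpha pi N x s).
Proof.
move=> x0; apply/nondecreasing_seqP => N; rewrite /cost expectS.
have gv0 : good_value M (fun _ _ => 0%R) := good_value_value M alpha_ge0 alpha_lt1 0.
have cE t (h : history R S t) : total_cost M alpha h = cost_to_go (fun _ _ => 0%R) h.
  by rewrite /cost_to_go mulr0 addr0.
apply: expect_le => // h ah; first by rewrite lee_fin total_cost_ge0.
rewrite cE; under [X in _ <= step X _]eq_fun do rewrite cE.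
apply: step_cost_to_go_ge => // y r z y0 /(feasibleP _ _ _ y0)[z0 dz _].
by rewrite addr_ge0 ?power_ge0// gtilde_ge0.
Qed.

Lemma cost_infE x s : (0 <= x)%R ->
  cost_inf alpha pi x s = ereal_sup (range (fun N => cost alpha pi N x s)).
Proof.
move=> x0; apply/cvg_lim => //; apply: ereal_nondecreasing_cvgn.
exact: cost_ndec.
Qed.

Lemma value_inf_le_cost_inf x s : (0 <= x)%R -> (w x s)%:E <= cost_inf alpha pi x s.
Proof.
move=> x0; rewrite cost_infE//.
have vle n : (v n x s)%:E <= ereal_sup (range (fun N => cost alpha pi N x s)).
  by apply: le_trans (value_le_cost n s x0) _; apply: ereal_sup_ubound; exists n.
(* A supremum [+oo] is trivial, and [-oo] is excluded by the bound at [n = 0]. *)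
case: (ereal_sup _) vle => [r|_|/(_ 0%N)//]; last exact: leey.
by move=> vr; rewrite lee_fin; exact: value_inf_le.
Qed.

End fixed_policy.

(** After adding the nonnegative terminal term [w], each slot meets the optimality equation with
    equality at the chosen action, so the expected cost-to-go never exceeds its initial value
    [w x s]. *)
Lemma cost_stationary_le N x s : 0 <= x ->
  (cost alpha stationary_policy N x s <= (w x s)%:E)%E.
Proof.
move=> x0; have gw : good_value M w := good_value_inf M alpha_ge0 alpha_lt1.
apply: (@le_trans _ _ (expect stationary_policy (t := N)
    (fun h => (cost_to_go w h)%:E) (x, s))).
  apply: expect_le => // h ah; rewrite lee_fin ?total_cost_ge0//.
  rewrite lerDl mulr_ge0 ?exprn_ge0//.
  by have [_ _ ->//] := gw (channel h); exact: admissible_level.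
elim: N => [|N IH]; first by rewrite /= lee_fin /cost_to_go/= add0r mul1r.
apply: le_trans IH; rewrite expectS; have [p0 _] := trans_stochastic M.
apply: expect_le => // h ah.
  by apply: step_ge0 => // h' ah'; rewrite lee_fin cost_to_go_ge0.
have h0 := admissible_level ah.
have [fz wE _] := stationary_ruleP M alpha_ge0 alpha_lt1 (channel h) h0.
pose F z := (\sum_(r : S) (trans M (channel h) r)%:E *
  (cost_to_go w ((h, z, r) : history R S N.+1))%:E)%E.
apply: (@le_trans _ _ (F (stationary_action h))).
  apply: (@integral_dirac_le _ (measurableTypeR R) R _ (stationary_action h) F fz).
  move=> z fz'; apply: sume_ge0 => r _.
  by rewrite mule_ge0 ?lee_fin// cost_to_go_ge0.
by rewrite /F mean_cost_to_go /cost_to_go -/w in wE *; rewrite wE.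
Qed.

Lemma stationary_policy_optimal : optimal alpha stationary_policy.
Proof.
move=> pi' x s x0; apply: le_trans (value_inf_le_cost_inf pi' s x0).
rewrite cost_infE//; apply: ge_ereal_sup => _ [N _ <-].
exact: cost_stationary_le.
Qed.

Lemma stationary_policy_for : stationary_for stationary_policy (zstar M alpha).
Proof. by move=> t h h0 A mA; rewrite (zstarE M alpha_ge0 alpha_lt1). Qed.

End policies.

Theorem theorem5 (R : realType) (dS : measure_display)
    (S : finMeasurableType dS) (M : model R S) (alpha : R)
    (alpha_ge0 : 0 <= alpha) (alpha_lt1 : alpha < 1) :
  (* (a) *)
  (forall x s, 0 <= x ->
     nondecreasing_seq (fun n => value M alpha n x s) /\
     cvgn (fun n => value M alpha n x s)) /\
  (* (b) *)
  (forall s, convex_function (`[0, +oo[%classic : set R)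
     (fun x => value_inf M alpha x s)) /\
  (* (c) *)
  [/\ forall y s, demand M <= y ->
        (forall m n, (1 <= m <= n)%N ->
           gfin M alpha m y s <= gfin M alpha n y s) /\
        gfin M alpha n y s @[n --> \oo] --> ginf M alpha y s,
      forall s, convex_function (`[demand M, +oo[%classic : set R)
        (fun y => ginf M alpha y s) &
      forall s, ginf M alpha y s @[y --> +oo] --> +oo] /\
  (* (d) *)
  (forall (k : int) s, -1 <= k <= (nbrk (curve M))%:Z ->
     bfin M alpha n k s @[n --> \oo] --> binf M alpha k s) /\
  (* (e) *)
  (forall x s, 0 <= x ->
     [/\ minimum
           [set power (curve M) z s + hold M (x + z - demand M) +
              alpha * \sum_(t : S) trans M s t *
                value_inf M alpha (x + z - demand M) t
            | z in feasible M x s]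
           (value_inf M alpha x s),
         minimum
           [set power (curve M) z s + ginf M alpha (x + z) s
            | z in feasible M x s]
           (value_inf M alpha x s),
         exists! z, zstar_spec M alpha x s z,
         feasible M x s (zstar M alpha x s) &
         value_inf M alpha x s =
           power (curve M) (zstar M alpha x s) s +
           ginf M alpha (x + zstar M alpha x s) s]) /\
  (* (f) *)
  (exists pi : policy M,
     stationary_for pi (zstar M alpha) /\ optimal alpha pi).
Proof.
split=> [x s x0|].
  split; first exact: value_ndec.
  by apply/cvg_ex; eexists; exact: value_cvg.
split=> [s|].
  by apply/convex_fromP; have [] := good_value_inf M alpha_ge0 alpha_lt1 s.
split.
  split=> [y s dy|s|s].
  - split=> [m n /andP[_ mn]|]; first exact: gfin_le.
    exact: gfin_cvg.
  - by apply/convex_fromP; have [] := good_post_ginf M alpha_ge0 alpha_lt1 s.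
  - exact: ginf_pinfty.
split=> [k s k1K|]; first exact: critical_cvg.
split=> [x s x0|].
  have [fz wE minw] := stationary_ruleP M alpha_ge0 alpha_lt1 s x0.
  have minimum_value : minimum
      [set power (curve M) z s + ginf M alpha (x + z) s | z in feasible M x s]
      (value_inf M alpha x s).
    by split; [exists (stationary_rule M alpha s x)|move=> _ [z /minw ? <-]].
  split=> //.
  - by under eq_imagel do rewrite -addrA; exact: minimum_value.
  - exists (stationary_rule M alpha s x); split; first exact: stationary_rule_spec.
    by move=> z zs; apply/esym; exact: zstar_spec_unique.
  - by rewrite zstarE.
  - by rewrite zstarE.
exists (stationary_policy M alpha_ge0 alpha_lt1); split.
  exact: stationary_policy_for.
exact: stationary_policy_optimal.
Qed.
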